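(* Let $\mathcal{U}\subset\mathbb{R}^m$ be finite, let $\sigma$ satisfy Assumption (A1) with $N$ auxiliary functions $\xi_1,\dots,\xi_N$, and let the recurrent neural network $\Sigma=(A,B,C,\mathcal{U},\sigma,x_0)$ be a realization of the input-output map $p:\mathcal{U}_{pc}\to PC([0,+\infty[,\mathbb{R}^{\mathrm{p}})$. Let $n=\dim(\Sigma)$. If one of the following conditions holds: (1) $\mathrm{trdeg}\,\mathcal{A}_{obs}(p)=n(1+|\mathcal{U}|N)$, or (2) $\mathrm{trdeg}\,\mathcal{A}_{obs}(\hat p)=n|\mathcal{U}|N$, then $\Sigma$ is a $\sigma$-minimal realization of $p$.
   Context: $PC([0,+\infty[,X)$ is the set of piecewise-continuous functions $[0,+\infty[\to X$, and $\mathcal{U}_{pc}$ is the set of piecewise-constant functions $[0,+\infty[\to\mathcal{U}$. Recurrent neural network (RNN): $\Sigma=(A,B,C,\mathcal{U},\sigma,x_0)$ with $A\in\mathbb{R}^{n\times n}$, $B\in\mathbb{R}^{n\times m}$, $C\in\mathbb{R}^{\mathrm{p}\times n}$, $x_0\in\mathbb{R}^n$, and $\sigma:\mathbb{R}\to\mathbb{R}$ continuous and globally Lipschitz (the activation function), denotes the system $\dot x(t)=\overrightarrow{\sigma}(Ax(t)+Bu(t))$, $x(0)=x_0$, $y(t)=Cx(t)$, where $\overrightarrow{\sigma}$ applies $\sigma$ componentwise. A solution is a triple $(x,u,y)$ with $u\in PC([0,+\infty[,\mathcal{U})$, $x$ absolutely continuous on $[0,+\infty[$, satisfying these equations; for each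 $u$ it exists and is unique. $\Sigma$ is a realization of $p$ if for every $u\in\mathcal{U}_{pc}$ the solution $(x,u,y)$ with $x(0)=x_0$ satisfies $p(u)=y$. $\dim(\Sigma)=n$. $\Sigma$ is a $\sigma$-minimal realization of $p$ if it is a realization of $p$ and no RNN $\Sigma'$ with the same activation function $\sigma$ is a realization of $p$ with $\dim(\Sigma')<\dim(\Sigma)$. Assumption (A1) on $\sigma$: $\sigma$ is real analytic and there exist an integer $N>0$, real analytic functions $\xi_1,\dots,\xi_N:\mathbb{R}\to\mathbb{R}$ and real polynomials $U_0,\dots,U_N,V_0,\dots,V_N$ in $N$ variables such that $V_k(\xi_1,\dots,\xi_N)$ is not the zero function for $0\le k\le N$, $\sigma V_0(\xi_1,\dots,\xi_N)=U_0(\xi_1,\dots,\xi_N)$, and $\dot\xi_i V_i(\xi_1,\dots,\xi_N)=U_i(\xi_1,\dots,\xi_N)$ for $1\le i\le N$. A map $\varphi:\mathcal{U}_{pc}\to PC([0,+\infty[,\mathbb{R})$ is causal if for all $t\ge0$ and $u,v\in\mathcal{U}_{pc}$ with $u=v$ on $[0,t]$, $\varphi(u)=\varphi(v)$ on $[0,t]$. It is analytic if for all $l>0$ and $\alpha_1,\dots,\alpha_l\in\mathcal{U}$ the function $([0,+\infty[)^l\to\mathbb{R}$, $(t_1,\dots,t_l)\mapsto\varphi(u)(T_l)$ is analytic, where $T_0=0$, $T_i=\sum_{j=1}^it_j$, $u(t)=\alpha_i$ on $[T_{i-1},T_i[$ and $u(t)=\alpha_l$ for $t\ge T_l$. $\mathcal{A}(\mathcal{U}_{pc})$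 is the real algebra (pointwise operations) of causal analytic maps $\mathcal{U}_{pc}\to PC([0,+\infty[,\mathbb{R})$; it is an integral domain. For $\varphi\in\mathcal{A}(\mathcal{U}_{pc})$ and $\alpha\in\mathcal{U}$, $D_\alpha\varphi\in\mathcal{A}(\mathcal{U}_{pc})$ is defined by $(D_\alpha\varphi(u))(t)=\frac{d}{ds}\varphi(u_\alpha)(t+s)|_{s=0}$ (right derivative), where $u_\alpha(\tau)=u(\tau)$ for $\tau\in[0,t[$ and $u_\alpha(\tau)=\alpha$ for $\tau\ge t$. For a causal analytic input-output map $g=(g_1,\dots,g_q)$ (all components in $\mathcal{A}(\mathcal{U}_{pc})$), the observation algebra $\mathcal{A}_{obs}(g)$ is the smallest subalgebra of $\mathcal{A}(\mathcal{U}_{pc})$ containing $g_1,\dots,g_q$ and closed under $D_\alpha$ for all $\alpha\in\mathcal{U}$. With $\mathcal{U}=\{\alpha_1,\dots,\alpha_K\}$, $K=|\mathcal{U}|$, the map $\hat p:\mathcal{U}_{pc}\to PC([0,+\infty[,\mathbb{R}^{\mathrm{p}K})$ is $\hat p(u)=(D_{\alpha_1}p(u),\dots,D_{\alpha_K}p(u))^T$, where $D_\alpha p(u)=(D_\alpha p_k(u))_{1\le k\le\mathrm{p}}$. (An input-output map realized by an RNN whose activation function satisfies (A1) is causal and analytic, so these objects are defined.) $\mathrm{trdeg}\,S$ of an integral domain $S$ over $\mathbb{R}$ is the transcendence degree over $\mathbb{R}$ of its field of fractions. *)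

(* Defs.v *)
From HB Require Import structures.
From mathcomp Require Import all_boot all_order all_algebra finmap.
From mathcomp Require Import all_classical all_reals all_analysis.
From mathcomp Require Import summability.
From mathcomp.multinomials Require Import -(notations) mpoly.

Set Implicit Arguments.
Unset Strict Implicit.
Unset Printing Implicit Defensive.

Import Order.TTheory GRing.Theory Num.Theory.
Import numFieldNormedType.Exports.

Local Open Scope classical_set_scope.
Local Open Scope ring_scope.

Section Signals.
Variable R : realType.

Definition time := {nonneg R}.

Lemma max0r_ge0 (t : R) : 0 <= Num.max 0 t.
Proof. by rewrite le_max lexx. Qed.

(* Extension of a function on [0, +oo[ to R by its value at 0: it carries the
   usual one- and two-sided limits and derivatives of [f] at times of R. *)
Definition ext (X : Type) (f : time -> X) (t : R) : X := f (NngNum (max0r_ge0 t)).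

(* Finitely many discontinuities on every bounded interval, and finite
   one-sided limits everywhere.  As [ext f] is constant on the left of 0,
   continuity of [ext f] at 0 is right-continuity of [f] there. *)
Definition piecewise_continuous (X : topologicalType) (f : time -> X) : Prop :=
  [/\ forall T : R,
        finite_set [set t | 0 <= t <= T /\ ~ {for t, continuous (ext f)}],
      forall t : R, 0 <= t -> exists l : X, ext f x @[x --> t^'+] --> l &
      forall t : R, 0 < t -> exists l : X, ext f x @[x --> t^'-] --> l].

(* The pieces are half-open, of the form t_i <= t < t_(i+1): on [0, T] there is a
   finite list [s] of switching times, and [u a = u b] as soon as no switching
   time x satisfies a < x <= b. *)
Definition piecewise_constant (X : Type) (u : time -> X) : Prop :=
  forall T : R, exists s : seq R, forall a b : time,
    a%:num <= b%:num <= T ->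
    (forall x, x \in s -> ~~ (a%:num < x <= b%:num)) -> u a = u b.

Definition absolutely_continuous (a b : R) (f : R -> R) : Prop :=
  forall e : R, 0 < e -> exists2 d : R, 0 < d &
    forall (n : nat) (I : 'I_n -> R * R),
      (forall i, a <= (I i).1 /\ (I i).1 <= (I i).2 /\ (I i).2 <= b) ->
      trivIset setT (fun i => `](I i).1, (I i).2[%classic) ->
      \sum_i ((I i).2 - (I i).1) < d ->
      \sum_i `|f (I i).2 - f (I i).1| < e.

Definition real_analytic (f : R -> R) : Prop :=
  forall a : R, exists c : nat -> R, exists2 r : R, 0 < r &
    forall x : R, `|x - a| < r -> pseries c (x - a) @ \oo --> f x.

(* Real analyticity on the closed orthant [0, +oo[^l: at each of its points,
   boundary points included, [F] is the (unconditional) sum of a power series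
   in [l] variables on a neighbourhood relative to the orthant. *)
Definition orthant_analytic (l : nat) (F : ('I_l -> time) -> R) : Prop :=
  forall a : 'I_l -> time,
  exists c : {ffun 'I_l -> nat} -> R, exists2 r : R, 0 < r &
    forall b : 'I_l -> time, (forall i, `|(b i)%:num - (a i)%:num| < r) ->
      partial_sum
        (fun k => c k * \prod_i ((b i)%:num - (a i)%:num) ^+ k i) @ totally
      --> F b.

(* [N] is the number of auxiliary functions; [U] and [V] are indexed by
   0, ..., N, the index [lift ord0 i] being i + 1. *)
Definition assumption_A1 (sigma : R -> R) (N : nat) : Prop :=
  real_analytic sigma /\ (0 < N)%N /\
  exists (xi : 'I_N -> R -> R) (U V : 'I_N.+1 -> mpoly.mpoly N R),
    [/\ forall i, real_analytic (xi i),
        forall k, exists x, mpoly.meval (xi^~ x) (V k) != 0,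
        forall x, sigma x * mpoly.meval (xi^~ x) (V ord0)
                  = mpoly.meval (xi^~ x) (U ord0) &
        forall i x, derive1 (xi i) x * mpoly.meval (xi^~ x) (V (lift ord0 i))
                    = mpoly.meval (xi^~ x) (U (lift ord0 i))].

End Signals.

Section Inputs.
Variables (R : realType) (m : nat) (U : {fset 'cV[R]_m}).
Local Notation time := (time R).

Record pc_input := PCInput {
  pc_fun :> time -> U;
  pc_funP : piecewise_constant pc_fun }.

Definition splice_fun (u : time -> U) (t : time) (alpha : U) : time -> U :=
  fun tau => if tau%:num < t%:num then u tau else alpha.

Lemma splice_pc (u : pc_input) t alpha :
  piecewise_constant (splice_fun u t alpha).
Proof.
move=> T; have [s us] := pc_funP u T.
exists (t%:num :: s) => a b abT nos; rewrite /splice_fun.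
have [ab _] := andP abT.
have := nos _ (mem_head _ _); rewrite negb_and -leNgt -ltNge.
case: (ltP a%:num t%:num) => [at_|ta]; case: (ltP b%:num t%:num) => [bt|tb] //=.
- by move=> _; apply: us => // x xs; apply: nos; rewrite inE xs orbT.
- by have := lt_le_trans (le_lt_trans ab bt) ta; rewrite ltxx.
Qed.

Definition splice (u : pc_input) (t : time) (alpha : U) : pc_input :=
  PCInput (@splice_pc u t alpha).

Lemma sum_time_ge0 l (t : 'I_l -> time) (i : nat) :
  0 <= \sum_(j < l | (j < i)%N) (t j)%:num.
Proof. exact: sumr_ge0. Qed.

(* T_i = t_1 + ... + t_i, for durations indexed from 0. *)
Definition switch_time (l : nat) (t : 'I_l -> time) (i : nat) : time :=
  NngNum (sum_time_ge0 t i).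

(* Since T_i is nondecreasing in i, the number of i in 1, ..., l with
   T_i <= tau is the (0-based) index of the piece containing [tau]. *)
Definition switched_fun (l : nat) (alpha : 'I_l.+1 -> U)
    (t : 'I_l.+1 -> time) : time -> U :=
  fun tau => alpha (inord
    (count (fun i => (switch_time t i)%:num <= tau%:num) (iota 1 l))).

Lemma switched_pc l alpha t : piecewise_constant (@switched_fun l alpha t).
Proof.
move=> T; exists [seq (switch_time t i)%:num | i <- iota 1 l] => a b abT nos.
have [ab _] := andP abT.
rewrite /switched_fun; congr (alpha (inord _)); apply: eq_in_count => i il.
have := nos _ (map_f _ il); rewrite negb_and -leNgt -ltNge => /orP[ia|bi].
  by rewrite ia (le_trans ia ab).
by rewrite !leNgt bi (le_lt_trans ab bi).
Qed.

Definition switched (l : nat) (alpha : 'I_l.+1 -> U) (t : 'I_l.+1 -> time) :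
  pc_input := PCInput (@switched_pc l alpha t).

Lemma switch_time_le l (t : 'I_l -> time) i j : (i <= j)%N ->
  (switch_time t i)%:num <= (switch_time t j)%:num.
Proof.
move=> ij /=; rewrite [leRHS](bigID (fun k : 'I_l => (k < i)%N)) /=.
rewrite [in leRHS](eq_bigl (fun k : 'I_l => (k < i)%N)); last first.
  by move=> k; case: (ltnP k i) => [ki|]; rewrite ?andbF // (leq_trans ki ij).
by rewrite lerDl sumr_ge0.
Qed.

Lemma switchedE l alpha t (i : 'I_l.+1) (tau : time) :
  (switch_time t i)%:num <= tau%:num ->
  tau%:num < (switch_time t i.+1)%:num \/ i = ord_max ->
  @switched l alpha t tau = alpha i.
Proof.
move=> Ti iT; rewrite /= /switched_fun; congr alpha; apply/val_inj => /=.
have il : (i <= l)%N by rewrite -ltnS.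
have -> : iota 1 l = iota 1 i ++ iota i.+1 (l - i).
  by rewrite -[in LHS](subnKC il) iotaD add1n.
rewrite count_cat; have /eqP -> : count (fun j => (switch_time t j)%:num <=
    tau%:num) (iota 1 i) == i.
  rewrite -[eqbRHS](size_iota 1) -all_count; apply/allP => j.
  rewrite mem_iota add1n ltnS => /andP[_ ji].
  exact: le_trans (switch_time_le t ji) Ti.
rewrite (_ : count _ (iota i.+1 _) = 0)%N ?addn0 ?inordK//.
case: iT => [iT|->]; last by rewrite subnn.
apply/eqP; rewrite -leqn0 leqNgt -has_count; apply/hasPn => j.
rewrite mem_iota => /andP[ij _]; rewrite -ltNge.
exact: lt_le_trans iT (switch_time_le t ij).
Qed.

(* The maps U_pc -> ([0, +oo[ -> R) form a commutative ring pointwise;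
   [cst (cst a)] is the scalar [a] in it. *)
Definition io_fun := pc_input -> time -> R.

Definition causal (phi : io_fun) : Prop :=
  forall (t : time) (u v : pc_input),
    (forall tau : time, tau%:num <= t%:num -> u tau = v tau) ->
    forall tau : time, tau%:num <= t%:num -> phi u tau = phi v tau.

Definition analytic_io (phi : io_fun) : Prop :=
  forall (l : nat) (alpha : 'I_l.+1 -> U),
    orthant_analytic (fun t => phi (switched alpha t) (switch_time t l.+1)).

Definition causal_analytic : set io_fun :=
  [set phi | [/\ forall u, piecewise_continuous (phi u),
                 causal phi & analytic_io phi]].

Definition D_ (alpha : U) (phi : io_fun) : io_fun := fun u t =>
  lim (s^-1 * (ext (phi (splice u t alpha)) (t%:num + s)
               - phi (splice u t alpha) t) @[s --> 0^'+]).

Definition subalgebra (S : set io_fun) : Prop :=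
  [/\ forall a : R, S (cst (cst a)),
      forall phi psi, S phi -> S psi -> S (phi + psi) &
      forall phi psi, S phi -> S psi -> S (phi * psi)].

(* The sets [S] stand for their trace on [causal_analytic]; [D_ alpha] is only
   meaningful on that trace. *)
Definition obs_algebra (q : nat) (g : pc_input -> time -> 'cV[R]_q) :
    set io_fun :=
  [set phi | causal_analytic phi /\
    forall S : set io_fun, subalgebra S ->
      (forall i, S (fun u t => g u t i 0)) ->
      (forall alpha psi, causal_analytic psi -> S psi -> S (D_ alpha psi)) ->
      S phi].

(* The blocks D_alpha p, for alpha ranging over an enumeration of U, stacked
   one above the other ([mxvec] lists a matrix row by row). *)
Definition hat (q : nat) (p : pc_input -> time -> 'cV[R]_q) :
    pc_input -> time -> 'cV[R]_(#|{: U}| * q) :=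
  fun u t => (mxvec (\matrix_(k < #|{: U}|, j < q)
                D_ (enum_val k) (fun v tau => p v tau j 0) u t))^T.

(* [L] is the field of fractions of the integral domain [S] through [iota],
   whose values outside [S] are irrelevant.  [L] is then an extension of R
   through [a |-> iota (cst (cst a))]. *)
Definition field_of_fractions (S : set io_fun) (L : fieldType)
    (iota : io_fun -> L) : Prop :=
  [/\ subalgebra S,
      iota 1 = 1,
      forall phi psi, S phi -> S psi ->
        iota (phi + psi) = iota phi + iota psi /\
        iota (phi * psi) = iota phi * iota psi,
      forall phi psi, S phi -> S psi -> iota phi = iota psi -> phi = psi &
      forall z : L, exists phi psi,
        [/\ S phi, S psi, psi != 0 & z = iota phi / iota psi]].

End Inputs.

Definition alg_independent (F L : fieldType) (k : F -> L) (d : nat)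
    (z : 'I_d -> L) : Prop :=
  forall P : mpoly.mpoly d F, mpoly.mmap k z P = 0 -> P = 0.

(* The largest cardinality of an algebraically independent family of [L] over
   [F], embedded in [L] by [k], is [d]. *)
Definition field_trdeg (F L : fieldType) (k : F -> L) (d : nat) : Prop :=
  (exists z : 'I_d -> L, alg_independent k z) /\
  (forall (e : nat) (z : 'I_e -> L), alg_independent k z -> (e <= d)%N).

(* [S] is an integral domain whose field of fractions has transcendence degree
   [d] over R. *)
Definition trdeg (R : realType) (m : nat) (U : {fset 'cV[R]_m})
    (S : set (io_fun U)) (d : nat) : Prop :=
  exists (L : fieldType) (iota : io_fun U -> L),
    field_of_fractions S iota /\ field_trdeg (fun a : R => iota (cst (cst a))) d.

Section RNN.
Variables (R : realType) (m : nat) (U : {fset 'cV[R]_m}) (sigma : R -> R).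
Variable q : nat.
Local Notation time := (time R).

(* The input set [U] enters only through the inputs of the solutions. *)
Record rnn := RNN {
  rnn_dim : nat;
  matA : 'M[R]_rnn_dim;
  matB : 'M[R]_(rnn_dim, m);
  matC : 'M[R]_(q, rnn_dim);
  x_init : 'cV[R]_rnn_dim;
  act_continuous : continuous sigma;
  act_lipschitz : lipschitz sigma }.

(* Absolute continuity on [0, +oo[ is meant on every bounded interval, and the
   differential equation holds for almost every time. *)
Definition solution (Sg : rnn) (x : time -> 'cV[R]_(rnn_dim Sg)) (u : time -> U)
    (y : time -> 'cV[R]_q) : Prop :=
  [/\ piecewise_continuous (fun t => val (u t)),
      forall (T : R) i, absolutely_continuous 0 T (fun t => ext x t i 0),
      {ae @lebesgue_measure R, forall t : R, 0 < t -> forall i,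
         is_derive t 1 (fun tau => ext x tau i 0)
           (sigma ((matA Sg *m ext x t + matB Sg *m val (ext u t)) i 0))},
      x 0%:nng = x_init Sg &
      forall t, y t = matC Sg *m x t].

Definition realization (Sg : rnn) (p : pc_input U -> time -> 'cV[R]_q) : Prop :=
  forall u : pc_input U, exists x, @solution Sg x u (p u).

Definition sigma_minimal (Sg : rnn) (p : pc_input U -> time -> 'cV[R]_q) :
    Prop :=
  realization Sg p /\
  ~ exists Sg' : rnn, realization Sg' p /\ (rnn_dim Sg' < rnn_dim Sg)%N.

End RNN.

(* Main.v *)
Require Import Defs.
From HB Require Import structures.
From mathcomp Require Import all_boot all_order all_algebra finmap.
From mathcomp Require Import all_classical all_reals all_analysis.
From mathcomp Require Import measurable_realfun summability.
From mathcomp Require Import ring lra.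
From mathcomp.multinomials Require Import -(notations) mpoly.

Set Implicit Arguments.
Unset Strict Implicit.
Unset Printing Implicit Defensive.

Import Order.TTheory GRing.Theory Num.Theory.
Import numFieldNormedType.Exports.

Local Open Scope classical_set_scope.
Local Open Scope ring_scope.

(* Let a network of dimension n' realize p. The functionals x_i (state
   components) and xi_j((Ax + B alpha)_i) number n'(1 + |U|N), and the field
   they generate is closed under every D_alpha, because sigma and the xi_j' are
   rational in the xi_j. Hence trdeg A_obs(p) <= n'(1 + |U|N); for hat p the
   states are not needed and the bound is n'|U|N. A realization with n' < n
   would contradict either hypothesis.

   "Rational" needs care: a denominator V_k(xi((Ax + B alpha)_i)) may vanish
   identically. We work with germs at an input word at which as many
   denominators as possible do not vanish. Near it every argument
   (Ax + B alpha)_i is either constant or has all its denominators nonzero, and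
   an element of the observation algebra vanishing near that word vanishes
   everywhere, by analyticity in the switching times. Only continuity, not
   analyticity, of the state in the switching times is used. *)

(** * Real analysis *)

(** The state being only continuous in the durations, functionals of a network near a word are not
    known to form an integral domain, so the bound is not read off a field generated by them.
    Instead, if [d] independent elements exceeded the number [D] of generators, counting
    coefficients would give a nontrivial relation between formal polynomials in [D] variables. It
    survives substitution of the generators, and only the resulting element of the observation
    algebra has to be analytic. Two mismatches shape the rest. The differential equation holds
    almost everywhere, while D_alpha takes a right derivative at a given time: an increment bound
    for absolutely continuous functions closes this gap. And D_alpha appends a letter to the input,
    so being near a word must include its continuations by short letters. Each hypothesis finally
    gives n <= n' by cancelling 1 + |U|N or |U|N. The latter is positive because N > 0 and because
    an empty U would leave no input, hence 1 = 0 in the field of fractions. *)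

Section RealInduction.
Variable R : realType.

(** The supremum of the [s] such that [P] holds on all of [[a, s]] satisfies [P] by the left step;
    were it below [b], the right step would push it further. *)
Lemma real_induction (a b : R) (P : R -> Prop) :
  P a ->
  (forall s, a <= s < b -> (forall x, a <= x <= s -> P x) ->
    exists2 r, 0 < r & forall x, s < x < s + r -> x <= b -> P x) ->
  (forall s, a < s <= b -> (forall x, a <= x < s -> P x) -> P s) ->
  forall x, a <= x <= b -> P x.
Proof.
move=> Pa Pright Pleft.
pose E := [set s : R | a <= s <= b /\ forall x, a <= x <= s -> P x].
move=> x /andP[ax xb]; have ab := le_trans ax xb.
have Ea : E a.
  split; first by rewrite lexx.
  by move=> y /andP[ay ya]; have -> : y = a by apply/le_anti/andP.
have ubE : ubound E b by move=> y [/andP[]].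
have supE : has_sup E by split; [exists a | exists b].
have aS : a <= sup E by apply: sup_upper_bound.
have Sb : sup E <= b by apply: sup_le_ub => //; exists a.
have below y : a <= y < sup E -> P y.
  move=> /andP[ay yS]; have [e [_ eP] ye] := sup_gt supE.1 yS.
  by apply: eP; rewrite ay ltW.
have PS : P (sup E).
  move: aS; rewrite le_eqVlt => /predU1P[<-//|aS].
  by apply: Pleft; rewrite ?aS.
have ES : E (sup E).
  split; first by rewrite aS.
  by move=> y /andP[ay]; rewrite le_eqVlt => /predU1P[->//|yS]; apply: below; rewrite ay.
have SE : sup E = b.
  apply/eqP; rewrite eq_le Sb /= leNgt; apply/negP => SltB.
  have [|r r0 Pr] := Pright (sup E) _ ES.2; first by rewrite aS.
  pose y := Num.min b (sup E + r / 2).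
  have Sy : sup E < y by rewrite lt_min SltB ltrDl divr_gt0.
  have : E y.
    split; first by rewrite (le_trans aS (ltW Sy)) ge_min lexx.
    move=> z /andP[az zy]; have [zS|Sz] := leP z (sup E).
      by apply: ES.2; rewrite az.
    apply: Pr; last by apply: le_trans zy _; rewrite ge_min lexx.
    rewrite Sz (le_lt_trans zy)// gt_min ltrD2l gtr_pMr// invf_lt1// ltr1n orbT//.
  by move=> /(sup_upper_bound supE); rewrite leNgt Sy.
by apply: ES.2; rewrite ax SE.
Qed.


(* The null set where [f] may fail to be differentiable is covered by an open
   set of small measure, whose contribution to the increment of [f] is small by
   absolute continuity. *)
Lemma absolutely_continuous_increment_le (a b M : R) (f : R -> R) :
  a <= b -> absolutely_continuous a b f ->
  {ae @lebesgue_measure R, forall t : R, a < t < b ->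
     exists2 l, is_derive t 1 f l & l <= M} ->
  f b - f a <= M * (b - a).
Proof.
move=> ab acf [E [mE E0 sub]].
apply/ler_addgt0Pr => e e0.
(* The slack [e] is split into [b - a] units for the derivative estimates, one for the variation of
   [f] over the exceptional intervals and one for the term [C * d']. *)
pose e1 := e / (b - a + 2).
have ba1 : 0 < b - a + 2 by rewrite ltr_wpDl// subr_ge0.
have e10 : 0 < e1 by rewrite divr_gt0.
have [d d0 acd] := acf _ e10.
pose C := `|M + e1|; have C0 : 0 <= C by exact: normr_ge0.
pose d' := Num.min d (e1 / (C + 1)).
have d'0 : 0 < d' by rewrite lt_min d0 divr_gt0// ltr_wpDl.
(* The endpoints join the exceptional set, as the hypothesis concerns the open interval. *)
pose E' := E `|` [set a] `|` [set b].
have mE' : measurable E' by apply: measurableU => //; apply: measurableU.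
have muE' : lebesgue_measure E' = 0.
  apply/eqP; rewrite -measure_le0.
  apply: le_trans (measureU2 _ _ _) _ => //; first exact: measurableU.
  rewrite [X in (_ + X)%E](_ : _ = 0%E) ?adde0; last exact: lebesgue_measure_set1.
  apply: le_trans (measureU2 _ _ _) _ => //.
  rewrite [X in (X + _)%E](_ : _ = 0%E) ?add0e; last exact: E0.
  by rewrite [leLHS](_ : _ = 0%E)//; exact: lebesgue_measure_set1.
have [|O [oO EO muO]] := @lebesgue_regularity_outer R E' d' mE' _ d'0.
  by rewrite [ltLHS](_ : _ = 0%E) ?ltry//; exact: muE'.
have mO : measurable O by exact: open_measurable.
have {}muO : (lebesgue_measure O < d'%:E)%E.
  apply: le_lt_trans muO.
  have {1}-> : O = E' `|` (O `\` E') by rewrite setDUK.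
  apply: le_trans (measureU2 _ _ _) _ => //; first exact: measurableD.
  by rewrite [X in (X + _)%E](_ : _ = 0%E) ?add0e//; exact: muE'.
(* [L] lists, latest first, the exceptional intervals met so far. The term in [C = |M + e1|] pays
   for the growth allowance [(M + e1) * (I.2 - I.1)], which may be negative. *)
pose P (s : R) := exists L : seq (R * R),
  [/\ pairwise (fun I J => J.2 <= I.1) L,
      forall I, I \in L -> [/\ a <= I.1, I.1 <= I.2, I.2 <= s &
                               `]I.1, I.2[ `<=` O] &
      f s - f a <= (M + e1) * (s - a) +
                   \sum_(I <- L) (`|f I.2 - f I.1| + C * (I.2 - I.1))].
(* Passing from [s] to [s'] across [c] serves both induction steps, with [s = c] on the right and
   [s' = c] on the left. If [c] is exceptional, [(s, s')] is added to [L]; otherwise the derivative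
   at [c] bounds the increment. *)
have step c : a <= c <= b -> exists2 r, 0 < r &
    forall s s', c - r < s <= c -> c <= s' < c + r -> a <= s -> s' <= b ->
      P s -> P s'.
  move=> /andP[ac cb]; have [cE|cE] := pselect (E' c).
    have /nbhs_ballP[r /= r0 rO] : nbhs c O by apply: open_nbhs_nbhs; split => //; exact: EO.
    exists r => // s s' /andP[rs sc] /andP[cs' s'r] as_ s'b [L [L1 L2 L3]].
    have ss' := le_trans sc cs'.
    exists ((s, s') :: L); split => /=.
    - by rewrite L1 andbT; apply/allP => I /L2[].
    - move=> I; rewrite inE => /predU1P[->|/L2[? ? ? ?]]; last first.
        by split => //; apply: le_trans ss'.
      split => //= z /=; rewrite in_itv /= => /andP[sz zs'].
      by apply: rO; rewrite /ball /= ltr_distl; lra.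
    - rewrite big_cons /=.
      have := ler_norm (f s' - f s).
      have : (M + e1) * (s' - s) >= - (C * (s' - s)).
        by rewrite -mulNr ler_wpM2r ?subr_ge0// lerNnormlW.
      by lra.
  have acb : a < c < b.
    rewrite !lt_neqAle ac cb !andbT; apply/andP; split; apply/eqP => h; apply: cE.
      by left; right.
    by right.
  have [l [dl fl] lM] : exists2 l, is_derive c 1 f l & l <= M.
    apply: contrapT => h; apply: cE; left; left; apply: sub => /= H; apply: h.
    exact: H.
  have : (fun h => h^-1 *: (f (h *: 1 + c) - f c)) @ 0^' --> l.
    by rewrite -fl; exact: dl.
  move=> /cvgrPdist_lt/(_ _ e10); rewrite /= /dnbhs /within.
  move=> /nbhs_ballP[r /= r0 rP].
  have incr x : `|x - c| < r -> `|f x - f c - l * (x - c)| <= e1 * `|x - c|.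
    have [->|xc] := eqVneq x c; first by rewrite !subrr normr0 !mulr0 subrr normr0.
    move=> xr; have xc0 : x - c != 0 by rewrite subr_eq0.
    have := rP (x - c); rewrite /ball /= sub0r normrN => /(_ xr xc0).
    rewrite scaler1 subrK => /ltW; rewrite -(ler_pM2r (_ : 0 < `|x - c|)) ?normr_gt0//.
    rewrite -normrM mulrBl /GRing.scale /= mulrAC mulVf// mul1r.
    by rewrite -normrN opprB.
  exists r => // s s' /andP[rs sc] /andP[cs' s'r] as_ s'b [L [L1 L2 L3]].
  have ss' := le_trans sc cs'.
  exists L; split => //.
    by move=> I /L2[? ? ? ?]; split => //; apply: le_trans ss'.
  have := incr s; have := incr s'.
  rewrite (ger0_norm (_ : 0 <= s' - c)) ?subr_ge0//.
  rewrite (ler0_norm (_ : s - c <= 0)) ?subr_le0//.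
  move=> /(_ ltac:(lra))/ler_normlP[_ h1] /(_ ltac:(lra))/ler_normlP[h2 _].
  have : (M - l) * (s' - s) >= 0 by rewrite mulr_ge0// subr_ge0.
  by lra.
have Pb : P b.
  apply: (@real_induction a b P); last by rewrite ab lexx.
  - by exists [::]; split => //; rewrite big_nil !subrr mulr0 addr0.
  - move=> s /andP[as_ sb] Ps; have [|r r0 rP] := step s; first by rewrite as_ ltW.
    exists r => // x /andP[sx xr] xb; apply: (rP s) => //; first by lra.
      by rewrite ltW.
    by apply: Ps; rewrite as_ lexx.
  - move=> s /andP[as_ sb] Ps; have [|r r0 rP] := step s; first by rewrite ltW.
    pose z := Num.max a (s - r / 2).
    have az : a <= z by rewrite le_max lexx.
    have zs : z < s by rewrite gt_max as_; lra.
    have rz : s - r < z by rewrite lt_max; apply/orP; right; lra.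
    by apply: (rP z) => //; [rewrite rz ltW|lra|apply: Ps; rewrite az].
have [L [L1 L2 L3]] := Pb.
pose I (i : 'I_(size L)) := tnth (in_tuple L) i.
have IL i : I i \in L by exact: mem_tnth.
have tI : trivIset setT (fun i => `](I i).1, (I i).2[%classic).
  move=> i j _ _ [x []] /=; rewrite !in_itv /=.
  wlog ij : i j / (i < j)%N.
    move=> wl h1 h2; have [/wl/(_ h1 h2)//|/wl/(_ h2 h1)->//|/val_inj//] := ltngtP i j.
  move=> /andP[h1 _] /andP[_ h2].
  have := pairwiseP (0, 0) L1; move=> /(_ i j (ltn_ord i) (ltn_ord j) ij) /=.
  move: h1 h2; rewrite /I !(tnth_nth (0,0)) /= => h1 h2 h3.
  by have := lt_trans h1 (lt_le_trans h2 h3); rewrite ltxx.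
have lenI : \sum_i ((I i).2 - (I i).1) < d'.
  rewrite -lte_fin; apply: le_lt_trans muO.
  rewrite -sumEFin [leLHS](_ : _ = \sum_i lebesgue_measure (`](I i).1, (I i).2[%classic))%E; last first.
    apply: eq_bigr => i _; have [_ h _ _] := L2 _ (IL i).
    rewrite lebesgue_measure_itv /= lte_fin; move: h; rewrite le_eqVlt => /predU1P[->|->].
      by rewrite ltxx subrr.
    by [].
  rewrite -measure_bigsetU_ord//.
  apply: le_measure; rewrite ?inE//.
    by apply: bigsetU_measurable => i _; exact: measurable_itv.
  apply: (big_ind (fun A => A `<=` O)); first exact: sub0set.
    by move=> A B AO BO x []; [apply: AO|apply: BO].
  by move=> i _; have [] := L2 _ (IL i).
have := acd _ I _ tI (lt_le_trans lenI _).
have IP i : a <= (I i).1 /\ (I i).1 <= (I i).2 /\ (I i).2 <= b.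
  by have [? ? ? _] := L2 _ (IL i).
have d'd : d' <= d by rewrite ge_min lexx.
move=> /(_ IP d'd) varI.
have Cd' : C * d' <= e1.
  apply: le_trans (_ : (C + 1) * d' <= _).
    by rewrite ler_wpM2r ?lerDl// ltW.
  rewrite mulrC -ler_pdivlMr; last by rewrite ltr_wpDl.
  by rewrite ge_min lexx orbT.
have {}L3 : f b - f a <= (M + e1) * (b - a) + (e1 + C * d').
  apply: le_trans L3 _; rewrite lerD2l big_split -mulr_sumr /=.
  have sumL (g : R * R -> R) : \sum_(J <- L) g J = \sum_i g (I i).
    exact: big_tnth.
  rewrite !sumL; apply: lerD; first exact: ltW.
  by rewrite ler_wpM2l// ltW.
have : e = e1 * (b - a + 2) by rewrite divfK// gt_eqF.
by lra.
Qed.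
End RealInduction.

(** * Right derivatives and a Gronwall estimate *)

Section RightDerivative.
Variable R : realType.
Implicit Types (f g h : R -> R) (t l : R).

Definition right_derivative f t l : Prop :=
  s^-1 * (f (t + s) - f t) @[s --> 0^'+] --> l.

Lemma eq_cvg_at (T : Type) (F : set_system T) (g' h : T -> R) (l : R) :
  g' =1 h -> g' @ F --> l -> h @ F --> l.
Proof. by move=> /funext ->. Qed.

Lemma near_cvg_at (T : Type) (F : set_system T) {FF : Filter F} (g' h : T -> R) (l : R) :
  {near F, g' =1 h} -> g' @ F --> l -> h @ F --> l.
Proof. by move=> e; apply: cvg_trans; apply: near_eq_cvg; apply: filterS e. Qed.

Lemma near_right0P (P : R -> Prop) :
  (\forall s \near 0^'+, P s) <-> exists2 r, 0 < r & forall s, 0 < s < r -> P s.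
Proof.
split=> [/nbhs_ballP[r /= r0 rP]|[r r0 rP]].
  exists r => // s /andP[s0 sr]; apply: rP => //.
  by rewrite /ball /= sub0r normrN gtr0_norm.
apply/nbhs_ballP; exists r => //= s; rewrite /ball /= sub0r normrN => sr s0.
by apply: rP; rewrite s0 (le_lt_trans (ler_norm _) sr).
Qed.

Lemma right_derivative_cvg f t l :
  right_derivative f t l -> f (t + s) @[s --> 0^'+] --> f t.
Proof.
move=> fl; have : s * (s^-1 * (f (t + s) - f t)) + f t @[s --> 0^'+] --> 0 * l + f t.
  apply: cvgD; last exact: cvg_cst.
  by apply: cvgM => //; apply: cvg_at_right_filter; exact: cvg_id.
rewrite mul0r add0r; apply: near_cvg_at; near=> s.
have s0 : s != 0 by rewrite gt_eqF//; near: s; exact: nbhs_right_gt.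
by rewrite mulrA mulfV// mul1r subrK.
Unshelve. all: end_near. Qed.

Lemma right_derivative_near f g t l :
  (\forall s \near 0^'+, f (t + s) = g (t + s)) -> f t = g t ->
  right_derivative f t l -> right_derivative g t l.
Proof.
move=> fg fgt; apply: near_cvg_at; near=> s.
by rewrite fgt; congr (_ * (_ - _)); near: s.
Unshelve. all: end_near. Qed.

Lemma right_derivative_cst (a t : R) : right_derivative (fun=> a) t 0.
Proof.
rewrite /right_derivative; under eq_fun do rewrite subrr mulr0.
exact: cvg_cst.
Qed.

Lemma right_derivativeD f g t l l' :
  right_derivative f t l -> right_derivative g t l' ->
  right_derivative (fun x => f x + g x) t (l + l').
Proof.
move=> fl gl; apply: (eq_cvg_at _ (cvgD fl gl)) => s.
by rewrite fctE -mulrDr; congr (_ * _); rewrite addrACA opprD.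
Qed.

Lemma right_derivativeM f g t l l' :
  right_derivative f t l -> right_derivative g t l' ->
  right_derivative (fun x => f x * g x) t (l * g t + f t * l').
Proof.
move=> fl gl; apply: (eq_cvg_at _ (cvgD (cvgM fl (right_derivative_cvg gl))
  (cvgM (cvg_cst (f t)) gl))) => s.
by rewrite fctE /GRing.mul_fun; ring.
Qed.

Lemma right_derivativeZ f (a t l : R) :
  right_derivative f t l -> right_derivative (fun x => a * f x) t (a * l).
Proof.
by move=> fl; have := right_derivativeM (right_derivative_cst a t) fl; rewrite mul0r add0r.
Qed.

Lemma right_derivative_sum (I : Type) (r : seq I) (P : pred I) (f : I -> R -> R)
    (t : R) (l : I -> R) :
  (forall i, right_derivative (f i) t (l i)) ->
  right_derivative (fun x => \sum_(i <- r | P i) f i x) t (\sum_(i <- r | P i) l i).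
Proof.
move=> fl; elim: r => [|i r IH].
  rewrite big_nil; under eq_fun do rewrite big_nil; exact: right_derivative_cst.
rewrite big_cons; under eq_fun do rewrite big_cons; case: (P i) => //.
exact: (right_derivativeD (fl i) IH).
Qed.

Lemma is_derive_right_derivative f t l :
  is_derive t 1 f l -> right_derivative f t l.
Proof.
move=> [df fl]; have : (fun s => s^-1 *: (f (s *: 1 + t) - f t)) @ 0^'+ --> l.
  by rewrite -fl; apply: cvg_dnbhs_at_right; exact: df.
by move=> H; apply: (eq_cvg_at _ H) => s; rewrite scaler1 [s + t]addrC.
Qed.

Lemma right_derivative_comp f h t l l' :
  right_derivative f t l -> is_derive (f t) 1 h l' ->
  right_derivative (fun x => h (f x)) t (l' * l).
Proof.
move=> fl [dh hl].
(* The slope of [h] from [f t], completed by [l'] to be continuous there: times with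
   [f (t + s) = f t] then need no separate treatment. *)
pose q y := if y == f t then l' else (h y - h (f t)) / (y - f t).
have qc : {for f t, continuous q}.
  apply/continuous_withinNx; rewrite /q eqxx.
  have : (fun x => x^-1 *: (h (x *: 1 + f t) - h (f t))) @ 0^' --> l'.
    by rewrite -hl; exact: dh.
  move=> /cvgrPdist_lt H; apply/cvgrPdist_lt => e e0.
  have /nbhs_ballP[r /= r0 rP] := H e e0.
  apply/nbhs_ballP; exists r => //= y yr yf; rewrite (negbTE yf).
  have := rP (y - f t); rewrite /ball /= sub0r normrN distrC => /(_ yr).
  by rewrite subr_eq0 => /(_ yf); rewrite scaler1 subrK /GRing.scale /= mulrC.
have qs : q (f (t + s)) @[s --> 0^'+] --> l'.
  have -> : l' = q (f t) by rewrite /q eqxx.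
  by apply: (cvg_comp _ _ (right_derivative_cvg fl)); exact: qc.
apply: (eq_cvg_at _ (cvgM qs fl)) => s.
rewrite /GRing.mul_fun /q; have [->|ne] := eqVneq (f (t + s)) (f t).
  by rewrite !subrr !mulr0.
by rewrite mulrCA mulfVK// subr_eq0.
Qed.

(** Real induction on [f s <= f a + e1 * (s - a)]: the slack [e1] absorbs the error of the
    difference quotient in the right step, and continuity gives the left step. *)
Lemma continuous_right_derivative_le0 f (a b : R) : a <= b -> continuous f ->
  (forall t, a <= t < b -> exists2 l, right_derivative f t l & l <= 0) ->
  f b <= f a.
Proof.
move=> ab cf fd; apply/ler_addgt0Pr => e e0.
pose e1 := e / (b - a + 1).
have ba1 : 0 < b - a + 1 by rewrite ltr_wpDl// subr_ge0.
have e10 : 0 < e1 by rewrite divr_gt0.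
have : f b <= f a + e1 * (b - a); last first.
  have : e = e1 * (b - a + 1) by rewrite divfK// gt_eqF.
  by lra.
apply: (@real_induction R a b (fun s => f s <= f a + e1 * (s - a))).
- by rewrite subrr mulr0 addr0.
- move=> s sab fs; have [l fl l0] := fd _ sab.
  have /cvgrPdist_lt/(_ _ e10)/near_right0P[r r0 rP] := fl.
  exists r => // x /andP[sx xr] _.
  have := fs s; rewrite lexx (andP sab).1 => /(_ isT) {}fs.
  have := rP (x - s); rewrite subr_gt0 sx ltrBlDl xr => /(_ isT).
  rewrite [s + _]addrC subrK => /ltr_normlP[h _].
  have : f x - f s <= e1 * (x - s); last by lra.
  by rewrite -ler_pdivrMr ?subr_gt0// mulrC; lra.
- move=> s /andP[as_ sb] fs; rewrite leNgt; apply/negP => h.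
  pose g x := f x - f a - e1 * (x - a).
  have cg : continuous g.
    move=> x; apply: cvgB; first by apply: cvgB; [exact: cf|exact: cvg_cst].
    by apply: cvgM; [exact: cvg_cst|apply: cvgB; [exact: cvg_id|exact: cvg_cst]].
  have gs : 0 < g s by rewrite /g; lra.
  have /cvgrPdist_lt/(_ _ gs)/nbhs_ballP[r /= r0 rP] := cg s.
  pose z := Num.max a (s - r / 2).
  have az : a <= z by rewrite le_max lexx.
  have zs : z < s by rewrite gt_max as_; lra.
  have rz : s - r < z by rewrite lt_max; apply/orP; right; lra.
  have := rP z; rewrite /ball /= gtr0_norm ?subr_gt0// => /(_ ltac:(lra)).
  have := fs z; rewrite az zs => /(_ isT) {}fs.
  by move=> /ltr_normlP[_]; rewrite /g; lra.
- by rewrite ab lexx.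
Qed.

(** The sum of squares [N] is right-differentiable where absolute values need not be. As
    [|z i| * |z j| <= N], its right derivative is at most [2 * K * N], so
    [expR (- (2 * K) * t) * N t] does not increase. *)
Lemma gronwall_sqr (n : nat) (z : 'I_n -> R -> R) (k : 'I_n -> 'I_n -> R) (d : R) :
  0 <= d -> (forall i j, 0 <= k i j) -> (forall i, continuous (z i)) ->
  (forall t i, 0 <= t < d ->
     exists2 l, right_derivative (z i) t l & `|l| <= \sum_j k i j * `|z j t|) ->
  \sum_i z i d ^+ 2 <=
    expR (2 * (\sum_i \sum_j k i j) * d) * \sum_i z i 0 ^+ 2.
Proof.
move=> d0 k0 cz zd; set K := \sum_i \sum_j k i j.
pose E (t : R) := expR (- (2 * K) * t).
pose N t := \sum_i z i t ^+ 2.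
have N0 t : 0 <= N t by apply: sumr_ge0 => i _; exact: sqr_ge0.
have dE t : is_derive t 1 E (- (2 * K) * E t).
  rewrite /E; apply: is_derive_eq.
  by rewrite /GRing.scale /= mulr1 mulrC.
suff : E d * N d <= E 0 * N 0.
  rewrite {2}/E mulr0 expR0 mul1r -(ler_pM2l (expR_gt0 (2 * K * d))) mulrA.
  by rewrite -expRD mulNr subrr expR0 mul1r.
apply: (@continuous_right_derivative_le0 (fun t => E t * N t)) => //.
  move=> t; apply: cvgM.
    by apply/differentiable_continuous/derivable1_diffP; have [] := dE t.
  apply: cvg_big => [|i _]; first exact: add_continuous.
  exact: (continuous_comp (cz i t) (@exprn_continuous _ 2 _)).
move=> t td.
have [l lP] : exists l : 'I_n -> R, forall i, right_derivative (z i) t (l i) /\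
    `|l i| <= \sum_j k i j * `|z j t|.
  have /choice[l lP] : forall i, exists l, right_derivative (z i) t l /\
     `|l| <= \sum_j k i j * `|z j t|.
    by move=> i; have [l ? ?] := zd t i td; exists l.
  by exists l.
exists (- (2 * K) * E t * N t + E t * \sum_i (l i * z i t + z i t * l i)).
  apply: right_derivativeM; first by apply: is_derive_right_derivative; exact: dE.
  by apply: right_derivative_sum => i; apply: right_derivativeM; exact: (lP i).1.
rewrite -mulrA mulrCA -mulrDr mulr_ge0_le0 ?expR_ge0//.
rewrite mulNr addrC subr_le0 -mulrA [leRHS]mulr_natl mulr_suml -sumrMnl.
apply: ler_sum => i _; rewrite [_ * z i t]mulrC -mulr2n lerMn2r/=.
apply: le_trans (ler_norm _) _; rewrite normrM mulrC.
apply: le_trans (ler_wpM2r (normr_ge0 _) (lP i).2) _.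
rewrite !mulr_suml; apply: ler_sum => j _; rewrite -mulrA ler_wpM2l//.
have zN m : `|z m t| ^+ 2 <= N t.
  by rewrite real_normK ?num_real// /N (bigD1 m)//= lerDl sumr_ge0// => ? _; exact: sqr_ge0.
have := zN i; have := zN j.
have : 0 <= (`|z j t| - `|z i t|) ^+ 2 by exact: sqr_ge0.
by rewrite sqrrB mulr2n; lra.
Qed.
End RightDerivative.

(** * Inputs as words *)

Section Words.
Variables (R : realType) (m : nat) (U : {fset 'cV[R]_m}).
Local Notation time := (time R).
Local Notation io_fun := (io_fun U).
Local Notation pc_input := (pc_input U).
Implicit Types (a b : nat -> U) (t : nat -> time) (l i : nat).

Lemma ext_num (X : Type) (f : time -> X) (t : time) : ext f t%:num = f t.
Proof. by rewrite /ext; congr f; apply/val_inj => /=; rewrite max_r. Qed.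

Lemma ext_ge0 (X : Type) (f : time -> X) (s : R) (s0 : 0 <= s) :
  ext f s = f (NngNum s0).
Proof. by rewrite -ext_num. Qed.

Lemma elapsed_ge0 t l : 0 <= \sum_(j < l) (t j)%:num.
Proof. exact: sumr_ge0. Qed.

Definition elapsed t l : time := NngNum (elapsed_ge0 t l).

Lemma elapsed0 t : (elapsed t 0)%:num = 0.
Proof. exact: big_ord0. Qed.

Lemma elapsedS t l : (elapsed t l.+1)%:num = (elapsed t l)%:num + (t l)%:num.
Proof. exact: big_ord_recr. Qed.

Lemma elapsed_le t i l : (i <= l)%N -> (elapsed t i)%:num <= (elapsed t l)%:num.
Proof.
elim: l => [|l IH]; first by rewrite leqn0 => /eqP ->.
rewrite leq_eqVlt => /predU1P[->//|/IH]; rewrite elapsedS => h.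
by apply: le_trans h _; rewrite lerDl.
Qed.

Lemma eq_elapsed t t' l : (forall i, (i < l)%N -> t i = t' i) ->
  elapsed t l = elapsed t' l.
Proof. by move=> tt'; apply/val_inj; apply: eq_bigr => i _; rewrite tt'. Qed.

Definition word_input a t l : pc_input :=
  switched (fun i : 'I_l.+1 => a i) (fun i : 'I_l.+1 => t i).

(** A relation rather than an equality of inputs: nothing is said from [elapsed t l] on, and letters
    of zero duration impose nothing. *)
Definition follows (u : time -> U) a t l : Prop :=
  forall i (tau : time), (i < l)%N ->
    (elapsed t i)%:num <= tau%:num < (elapsed t i.+1)%:num -> u tau = a i.

Lemma switch_timeE t l i : (i <= l.+1)%N ->
  switch_time (fun i : 'I_l.+1 => t i) i = elapsed t i.
Proof.
move=> il; apply/val_inj => /=.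
by rewrite (big_ord_widen_cond l.+1 xpredT (fun j => (t j)%:num) il).
Qed.

Lemma word_input_follows a t l : follows (word_input a t l) a t l.
Proof.
move=> i tau il /andP[h1 h2]; have il' : (i < l.+1)%N := ltnW il.
rewrite /word_input (@switchedE _ _ _ _ _ _ (Ordinal il')) ?switch_timeE//=.
  by rewrite ltnW.
by left.
Qed.

Lemma word_input_last a t l (tau : time) :
  (elapsed t l)%:num <= tau%:num -> word_input a t l tau = a l.
Proof.
move=> h; rewrite /word_input (@switchedE _ _ _ _ _ _ ord_max) ?switch_timeE//=.
by right.
Qed.

Lemma follows_agree (u v : time -> U) a t l : follows u a t l -> follows v a t l ->
  forall tau : time, tau%:num < (elapsed t l)%:num -> u tau = v tau.
Proof.
elim: l => [|l IH] fu fv tau; first by rewrite elapsed0 ltNge ge0.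
move=> h; have [tl|lt] := ltP tau%:num (elapsed t l)%:num.
  apply: (IH _ _ tau tl) => i s il; first exact: (fu i s (leqW il)).
  exact: (fv i s (leqW il)).
by rewrite (fu l)// ?lt// (fv l)// lt.
Qed.

Lemma follows_eq (u : time -> U) a b t t' l :
  (forall i, (i < l)%N -> a i = b i) -> (forall i, (i < l)%N -> t i = t' i) ->
  follows u a t l -> follows u b t' l.
Proof.
move=> ab tt' fu i tau il; rewrite -ab// -!(@eq_elapsed t t').
- exact: fu.
- by move=> j ji; rewrite tt'//; apply: leq_trans il; exact: ji.
- by move=> j ji; rewrite tt'//; exact: ltn_trans il.
Qed.

(** Unlike with [causal], the input at [tau] itself does not count, so the value at [tau] is
    unchanged by splicing a letter there. States have this property, being determined by
    integration. *)
Definition strictly_causal (X : Type) (phi : pc_input -> time -> X) : Prop :=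
  forall (u v : pc_input) (tau : time),
    (forall s : time, s%:num < tau%:num -> u s = v s) -> phi u tau = phi v tau.

Definition word_value (X : Type) (phi : pc_input -> time -> X) a t l : X :=
  phi (word_input a t l) (elapsed t l).

Lemma follows_value (X : Type) (phi : pc_input -> time -> X) (u : pc_input)
    a t l : strictly_causal phi -> follows u a t l ->
  phi u (elapsed t l) = word_value phi a t l.
Proof.
by move=> sc fu; apply: sc; apply: follows_agree fu _; exact: word_input_follows.
Qed.

Lemma eq_word_value (X : Type) (phi : pc_input -> time -> X) a b t t' l :
  strictly_causal phi -> (forall i, (i < l)%N -> a i = b i) ->
  (forall i, (i < l)%N -> t i = t' i) ->
  word_value phi a t l = word_value phi b t' l.
Proof.
move=> sc ab tt'; rewrite {1}/word_value (eq_elapsed tt').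
by apply: follows_value => //; apply: follows_eq ab tt' (@word_input_follows _ _ _).
Qed.

Definition upd (X : Type) (f : nat -> X) l (x : X) : nat -> X :=
  fun i => if i == l then x else f i.

Lemma upd_lt (X : Type) (f : nat -> X) l (x : X) i : (i < l)%N -> upd f l x i = f i.
Proof. by rewrite /upd; case: eqVneq => // ->; rewrite ltnn. Qed.

Lemma upd_eq (X : Type) (f : nat -> X) l (x : X) : upd f l x l = x.
Proof. by rewrite /upd eqxx. Qed.

Lemma elapsed_upd t l (s : time) :
  (elapsed (upd t l s) l.+1)%:num = (elapsed t l)%:num + s%:num.
Proof.
rewrite elapsedS upd_eq (@eq_elapsed _ t)// => i il; exact: upd_lt.
Qed.

Lemma follows_splice a t l alpha (s : time) :
  follows (splice (word_input a t l) (elapsed t l) alpha) (upd a l alpha)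
    (upd t l s) l.+1.
Proof.
have eqt k : (k <= l)%N -> elapsed (upd t l s) k = elapsed t k.
  by move=> kl; apply: eq_elapsed => j jk; rewrite upd_lt// (leq_trans jk).
move=> i tau; rewrite ltnS leq_eqVlt => /predU1P[->|il].
  rewrite eqt// => /andP[h _] /=; rewrite /splice_fun ltNge h /=.
  by rewrite upd_eq.
rewrite !eqt ?upd_lt// 1?ltnW// => /andP[h1 h2].
have h3 : tau%:num < (elapsed t l)%:num by apply: lt_le_trans h2 (elapsed_le t il).
have -> : splice (word_input a t l) (elapsed t l) alpha tau = word_input a t l tau.
  by rewrite /= /splice_fun h3.
by apply: (@word_input_follows a t l i tau il); rewrite h1.
Qed.

(** Splicing at the end of a word appends a letter, so [D_ alpha] becomes a derivative in the
    duration of a new last letter. *)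
Lemma splice_value (phi : io_fun) a t l alpha (s : time) : strictly_causal phi ->
  ext (phi (splice (word_input a t l) (elapsed t l) alpha))
    ((elapsed t l)%:num + s%:num) =
  word_value phi (upd a l alpha) (upd t l s) l.+1.
Proof.
move=> sc; rewrite -elapsed_upd ext_num; apply: follows_value => //.
exact: follows_splice.
Qed.

Lemma splice_now (X : Type) (phi : pc_input -> time -> X) u (tau : time) alpha :
  strictly_causal phi -> phi (splice u tau alpha) tau = phi u tau.
Proof. by apply=> s st /=; rewrite /splice_fun st. Qed.

Lemma piecewise_constant_right (u : pc_input) (tau : time) :
  exists2 r : R, 0 < r &
    forall s : time, tau%:num <= s%:num < tau%:num + r -> u s = u tau.
Proof.
have [L LP] := pc_funP u (tau%:num + 1).
have [r r0 rP] : exists2 r : R, 0 < r & forall x, x \in L -> tau%:num < x -> tau%:num + r <= x.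
  elim: L {LP} => [|x L [r r0 rP]]; first by exists 1.
  have [xt|tx] := leP x tau%:num.
    by exists r => // y; rewrite inE => /predU1P[->|/rP//]; rewrite ltNge xt.
  exists (Num.min r (x - tau%:num)); first by rewrite lt_min r0 subr_gt0.
  move=> y; rewrite inE -lerBrDl ge_min => /predU1P[->|/rP h /h]; first by rewrite lexx orbT.
  by rewrite -lerBrDl => ->.
exists (Num.min r 1); first by rewrite lt_min r0 ltr01.
move=> s /andP[ts]; rewrite -ltrBlDl lt_min !ltrBlDl => /andP[sr s1].
apply/esym/LP; first by rewrite ts ltW.
move=> x xL; apply/negP => /andP[tx xs]; have := rP x xL tx.
by rewrite leNgt (le_lt_trans xs sr).
Qed.

(** Induction on the number of listed switching times strictly between 0 and [tau]: the input is
    constant from the largest of them, [z], up to [tau], and fewer remain before [z]. *)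
Lemma piecewise_constant_follows (u : pc_input) (tau : time) :
  exists a t l, follows u a t l /\ tau = elapsed t l.
Proof.
have [L LP] := pc_funP u tau%:num.
have [n] := ubnP (size [seq x <- L | 0 < x < tau%:num]).
have {LP} : forall c d : time, c%:num <= d%:num < tau%:num ->
    (forall x, x \in L -> ~~ (c%:num < x <= d%:num)) -> u c = u d.
  by move=> c d /andP[cd dt]; apply: LP; rewrite cd ltW.
elim: n tau => // n IH tau LP; set L' := [seq _ <- _ | _] => /ltnSE sz.
have [z zP] : exists z : time, [/\ z%:num <= tau%:num,
    forall s : time, z%:num <= s%:num < tau%:num -> u s = u z &
    L' = [::] /\ z%:num = 0 \/ z%:num \in L'].
  case E: L' => [|x0 L0].
    exists 0%:nng; split; [exact: ge0| |by left].
    move=> s /andP[s0 st]; apply/esym/LP; first by rewrite s0.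
    move=> x xL; apply/negP => /andP[x0 xs].
    have : x \in L' by rewrite mem_filter xL x0 (le_lt_trans xs st).
    by rewrite E.
  have [z zL zmax] : exists2 z, z \in L' & forall x, x \in L' -> x <= z.
    rewrite {}E; elim: L0 x0 => [|y L0 IHL] x0.
      by exists x0; rewrite ?mem_head// => x; rewrite inE => /eqP ->.
    have [z zL zP] := IHL y; have [xz|zx] := leP x0 z.
      exists z; first by rewrite inE zL orbT.
      by move=> x; rewrite inE => /predU1P[->//|/zP].
    exists x0; rewrite ?mem_head// => x; rewrite inE => /predU1P[->//|/zP h].
    exact: le_trans h (ltW zx).
  move: (zL); rewrite mem_filter => /andP[/andP[z0 zt] _].
  exists (NngNum (ltW z0)); split => /=; [exact: ltW| |by right; rewrite -E].
  move=> s /andP[zs st]; apply/esym/LP; first by rewrite zs.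
  move=> x xL; apply/negP => /andP[zx xs].
  have : x \in L' by rewrite mem_filter xL (lt_trans z0 zx) (le_lt_trans xs st).
  by move=> /zmax; rewrite leNgt zx.
have [zt zu zL] := zP.
have [a [t [l [fu zE]]]] : exists a t l, follows u a t l /\ z = elapsed t l.
  case: zL => [[_ z0]|zL].
    exists (fun=> u z), (fun=> 0%:nng), 0%N; split => //.
    by apply/val_inj; rewrite [RHS]elapsed0.
  apply: IH.
    move=> c d /andP[cd dz]; apply: LP; rewrite cd; exact: lt_le_trans dz zt.
  apply: leq_trans sz.
  have -> : [seq x <- L | 0 < x < z%:num] = [seq x <- L' | x < z%:num].
    rewrite -filter_predI; apply: eq_filter => x /=.
    case: (ltP x z%:num) => [xz|]; rewrite ?andbF//= andbT.
    by rewrite (lt_le_trans xz zt) andbT.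
  rewrite size_filter -(count_predC (fun x => x < z%:num) L') -[ltnLHS]addn0 ltn_add2l -has_count.
  by apply/hasP; exists z%:num => //=; rewrite ltxx.
have dt : 0 <= tau%:num - z%:num by rewrite subr_ge0.
exists (upd a l (u z)), (upd t l (NngNum dt)), l.+1; split; last first.
  by apply/val_inj; rewrite [RHS]elapsed_upd -zE /= addrC subrK.
have eqt k : (k <= l)%N -> elapsed (upd t l (NngNum dt)) k = elapsed t k.
  by move=> kl; apply: eq_elapsed => j jk; rewrite upd_lt// (leq_trans jk).
move=> i s; rewrite ltnS leq_eqVlt => /predU1P[->|il].
  by rewrite elapsed_upd eqt// -zE /= addrCA subrr addr0 upd_eq; exact: zu.
by rewrite !eqt ?upd_lt// 1?ltnW//; exact: fu.
Qed.
End Words.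

(** * Neighbourhoods of the durations of a word *)

Section WordNbhs.
Variable R : realType.
Implicit Types (t : nat -> time R) (l : nat).

Definition word_nbhs t l : set_system (nat -> time R) :=
  filter_from [set e : R | 0 < e]
    (fun e => [set t' | forall i, (i < l)%N -> `|(t' i)%:num - (t i)%:num| < e]).

Global Instance word_nbhs_filter t l : ProperFilter (word_nbhs t l).
Proof.
apply: filter_from_proper => [|e e0]; last first.
  by exists t => i _; rewrite subrr normr0.
apply: filter_from_filter; first by exists 1 => /=.
move=> e e' /= e0 e'0; exists (Num.min e e'); first by rewrite /= lt_min e0.
by move=> t' /= h; split=> i /h; rewrite lt_min => /andP[].
Qed.

Lemma cvg_word_time t l i : (i < l)%N -> (t' i)%:num @[t' --> word_nbhs t l] --> (t i)%:num.
Proof.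
move=> il; apply/cvgrPdist_lt => e e0; exists e => //= t' /(_ i il).
by rewrite distrC.
Qed.
End WordNbhs.

Lemma ae_lebesgue_mono (R : realType) (P Q : R -> Prop) : (forall t, P t -> Q t) ->
  {ae @lebesgue_measure R, forall t, P t} -> {ae @lebesgue_measure R, forall t, Q t}.
Proof.
move=> PQ [A [mA A0 sub]]; exists A; split => //; apply: subset_trans sub => t.
by apply: contra_not; exact: PQ.
Qed.

(** * Regularity of the state *)

Section State.
Variables (R : realType) (m q : nat) (U : {fset 'cV[R]_m}) (sigma : R -> R).
Variables (Sg : rnn m sigma q) (p : pc_input U -> time R -> 'cV[R]_q).
Local Notation n := (rnn_dim Sg).
Variable x : pc_input U -> time R -> 'cV[R]_n.
Hypothesis xP : forall u : pc_input U, solution (x u) u (p u).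

Definition pre_activation (alpha : U) (i : 'I_n) (u : pc_input U) (t : time R) : R :=
  (matA Sg *m x u t + matB Sg *m val alpha) i 0.

Lemma absolutely_continuous_continuous_ext (f : time R -> R) :
  (forall T : R, absolutely_continuous 0 T (ext f)) -> continuous (ext f).
Proof.
move=> ac t; apply/cvgrPdist_lt => e e0.
pose T := Num.max 0 t + 1.
have [d d0 dP] := ac T e e0.
have extE s : ext f s = ext f (Num.max 0 s).
  by rewrite /ext; congr f; apply/val_inj => /=; rewrite maxA maxxx.
apply/nbhs_ballP; exists (Num.min d 1) => /=; first by rewrite lt_min d0 ltr01.
move=> s; rewrite /ball /= => st.
rewrite (extE t) (extE s).
pose a := Num.min (Num.max 0 t) (Num.max 0 s); pose b := Num.max (Num.max 0 t) (Num.max 0 s).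
have a0 : 0 <= a by rewrite le_min !le_max lexx.
have ab : a <= b by rewrite ge_min le_max lexx.
have bat : b - a <= `|t - s|.
  rewrite /a /b; have [h|h] := leP (Num.max 0 t) (Num.max 0 s);
  move: h; rewrite /Num.max; case: (ltP 0 t) => h1; case: (ltP 0 s) => h2 h3;
  have := ler_norm (t - s); have := ler_norm (s - t); rewrite (distrC s); lra.
have bT : b <= T.
  rewrite ge_max lerDl ler01 /= ge_max /T.
  have : t <= Num.max 0 t by rewrite le_max lexx orbT.
  have : 0 <= Num.max 0 t by rewrite le_max lexx.
  by have := ler_norm (s - t); move: st; rewrite distrC lt_min => /andP[_]; lra.
have -> : `|ext f (Num.max 0 t) - ext f (Num.max 0 s)| = `|ext f b - ext f a|.
  by rewrite /a /b; case: (leP (Num.max 0 t) (Num.max 0 s)) => // _; rewrite distrC.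
have := dP 1%N (fun=> (a, b)); rewrite !big_ord1 /=; apply=> //.
  by move=> i j _ _ _; rewrite !ord1.
by apply: le_lt_trans bat _; move: st; rewrite lt_min => /andP[].
Qed.

Lemma state_continuous u i : continuous (ext (fun t => x u t i 0)).
Proof.
apply: absolutely_continuous_continuous_ext => T.
by have [_ h _ _ _] := xP u; exact: h.
Qed.

Lemma pre_activationE alpha i u t :
  pre_activation alpha i u t =
  \sum_j matA Sg i j * x u t j 0 + (matB Sg *m val alpha) i 0.
Proof. by rewrite /pre_activation !mxE. Qed.

Lemma pre_activation_continuous alpha i u : continuous (ext (pre_activation alpha i u)).
Proof.
have -> : ext (pre_activation alpha i u) = (fun t => \sum_j matA Sg i j *
    ext (fun t => x u t j 0) t + (matB Sg *m val alpha) i 0).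
  by apply/funext => t; rewrite /ext pre_activationE.
move=> t; apply: cvgD; last exact: cvg_cst.
apply: cvg_big => [|j _]; first exact: add_continuous.
by apply: cvgM; [exact: cvg_cst|exact: state_continuous].
Qed.

(** The input is constant just after [t], so the right-hand side of the equation is continuous there
    and within [e] of [h]. The increment bound, applied to [f] and to [- f], confines the difference
    quotient to [[h - e, h + e]], although the equation itself may fail at [t]. *)
Lemma state_right_derivative u (t : time R) i :
  right_derivative (ext (fun s => x u s i 0)) t%:num
    (sigma (pre_activation (u t) i u t)).
Proof.
set f := ext _; set h := sigma _.
have [r r0 ur] := piecewise_constant_right u t.
have [_ ac ode _ _] := xP u.
have ch : continuous (fun s => sigma (ext (pre_activation (u t) i u) s)).
  move=> s; apply: continuous_comp; first exact: pre_activation_continuous.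
  exact: (act_continuous Sg).
have hE : h = sigma (ext (pre_activation (u t) i u) t%:num) by rewrite ext_num.
apply/cvgrPdist_le => e e0.
have /cvgrPdist_le/(_ _ e0)/nbhs_ballP[r' /= r'0 r'P] := ch t%:num.
apply/near_right0P; exists (Num.min r r'); first by rewrite lt_min r0.
move=> s /andP[s0]; rewrite lt_min => /andP[sr sr'].
have der : {ae @lebesgue_measure R, forall tau : R, t%:num < tau < t%:num + s ->
    exists l, is_derive tau 1 f l /\ `|h - l| <= e}.
  apply: ae_lebesgue_mono ode => tau ode /andP[ttau taut].
  have tau0 : 0 < tau by apply: le_lt_trans ttau.
  exists (sigma (ext (pre_activation (u t) i u) tau)); split; last first.
    rewrite hE; apply: r'P; rewrite /ball /= distrC gtr0_norm ?subr_gt0//.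
    by rewrite ltrBlDl (lt_trans taut)// ltrD2l.
  have := ode tau0 i; rewrite /pre_activation !(ext_ge0 _ (ltW tau0)).
  rewrite (ur (NngNum (ltW tau0)))//=.
  by rewrite (ltW ttau) (lt_trans taut)// ltrD2l.
have acs : absolutely_continuous t%:num (t%:num + s) f.
  move=> e1 e10; have [d d0 dP] := ac (t%:num + s) i e1 e10; exists d => // k I IP.
  apply: dP => j; have [h1 [h2 h3]] := IP j; split; last by [].
  exact: le_trans h1.
have ts : t%:num <= t%:num + s by rewrite lerDl ltW.
have up := @absolutely_continuous_increment_le R _ _ (h + e) _ ts acs.
have acN : absolutely_continuous t%:num (t%:num + s) (- f).
  move=> e1 e10; have [d d0 dP] := acs e1 e10; exists d => // k I I1 I2 I3.
  have := dP k I I1 I2 I3; apply: le_lt_trans; apply: ler_sum => j _.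
  by rewrite -normrN fctE !opprD !opprK.
have lo := @absolutely_continuous_increment_le R _ _ (- h + e) _ ts acN.
have {}up : f (t%:num + s) - f t%:num <= (h + e) * s.
  move: up; rewrite addrAC subrr add0r; apply; apply: ae_lebesgue_mono der => tau H /H[l [dl hl]]; exists l => //.
  by move: hl => /ler_normlP[]; lra.
have {}lo : - f (t%:num + s) + f t%:num <= (- h + e) * s.
  move: lo; rewrite addrAC subrr add0r fctE opprK; apply; apply: ae_lebesgue_mono der => tau H /H[l [dl hl]]; exists (- l).
    exact: is_deriveN.
  by move: hl => /ler_normlP[]; lra.
rewrite ler_distlC mulrC ler_pdivlMr// ler_pdivrMr//.
by apply/andP; split; lra.
Qed.

Lemma act_lipschitz_const : exists2 L : R, 0 <= L & forall y z, `|sigma y - sigma z| <= L * `|y - z|.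
Proof.
have [L [L0 LP]] := act_lipschitz Sg.
exists (Num.max 0 L + 1).
  by rewrite addr_ge0// le_max lexx.
move=> y z; apply: (LP _ _ (y, z)) => //.
by rewrite (@le_lt_trans _ _ (Num.max 0 L))// ?ltrDl// le_max lexx orbT.
Qed.

(** The different starting times [a] and [b] allow the comparison of one letter of two words whose
    earlier durations differ. [K] comes from the Lipschitz constant and [matA], and is the same for
    all inputs. *)
Lemma state_gronwall : exists K : R, forall (u v : pc_input U) (a b d : time R),
  (forall s : R, 0 <= s < d%:num -> ext u (a%:num + s) = ext v (b%:num + s)) ->
  \sum_i (ext (fun t => x u t i 0) (a%:num + d%:num) -
          ext (fun t => x v t i 0) (b%:num + d%:num)) ^+ 2 <=
  expR (K * d%:num) * \sum_i (x u a i 0 - x v b i 0) ^+ 2.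
Proof.
have [L L0 LP] := act_lipschitz_const.
exists (2 * (\sum_i \sum_j L * `|matA Sg i j|)) => u v a b d uv.
pose z i s := ext (fun t => x u t i 0) (a%:num + s) - ext (fun t => x v t i 0) (b%:num + s).
have z0 i : z i 0 = x u a i 0 - x v b i 0 by rewrite /z !addr0 !ext_num.
have -> : \sum_i (x u a i 0 - x v b i 0) ^+ 2 = \sum_i z i 0 ^+ 2.
  by apply: eq_bigr => i _; rewrite z0.
apply: (@gronwall_sqr R _ z (fun i j => L * `|matA Sg i j|)) => //.
- by move=> i j; rewrite mulr_ge0.
- move=> i s; apply: cvgB.
    by apply: continuous_comp; [apply: cvgD; [exact: cvg_cst|exact: cvg_id]|exact: state_continuous].
  by apply: continuous_comp; [apply: cvgD; [exact: cvg_cst|exact: cvg_id]|exact: state_continuous].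
move=> s i sd; have s0 : 0 <= s by case/andP: sd.
have as0 : 0 <= a%:num + s by rewrite addr_ge0.
have bs0 : 0 <= b%:num + s by rewrite addr_ge0.
have du := @state_right_derivative u (NngNum as0) i.
have dv := @state_right_derivative v (NngNum bs0) i.
have uvs := uv s sd; rewrite (ext_ge0 _ as0) (ext_ge0 _ bs0) in uvs.
exists (sigma (pre_activation (u (NngNum as0)) i u (NngNum as0)) -
        sigma (pre_activation (v (NngNum bs0)) i v (NngNum bs0))).
  move: du dv; rewrite /right_derivative /= => du dv.
  apply: (eq_cvg_at _ (cvgB du dv)) => tau.
  by rewrite fctE -mulrBr /z !addrA; congr (_ * _); rewrite !opprD !opprK addrACA.
apply: le_trans (LP _ _) _; rewrite uvs !pre_activationE opprD addrACA subrr addr0.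
rewrite -sumrB.
under [leRHS]eq_bigr do rewrite -mulrA.
rewrite -mulr_sumr ler_wpM2l//; apply: le_trans (ler_norm_sum _ _ _) _.
apply: ler_sum => j _; rewrite -mulrBr normrM /z (ext_ge0 _ as0) (ext_ge0 _ bs0).
by [].
Qed.

(** Uniqueness of solutions: the Gronwall estimate from the common initial state makes the distance
    at time [d] vanish. *)
Lemma state_strictly_causal : strictly_causal x.
Proof.
move=> u v d uv; have [K KP] := state_gronwall.
pose o : time R := NngNum (lexx (0 : R)).
have xo w : x w o = x_init Sg.
  by have [_ _ _ <- _] := xP w; congr (x w _); exact/val_inj.
have := KP u v o o d; have -> : \sum_i (x u o i 0 - x v o i 0) ^+ 2 = 0.
  by rewrite big1// => i _; rewrite !xo subrr expr0n.
rewrite mulr0 /= add0r => h.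
have {}h : \sum_i (x u d i 0 - x v d i 0) ^+ 2 <= 0.
  have E w i : x w d i 0 = ext (fun t => x w t i 0) d%:num by rewrite ext_num.
  under eq_bigr do rewrite !E.
  apply: h => s /andP[s0 sd]; rewrite add0r !(ext_ge0 _ s0); exact: uv.
apply/matrixP => i j; rewrite ord1; apply/eqP; rewrite -subr_eq0 -sqrf_eq0.
rewrite eq_le sqr_ge0 andbT; apply: le_trans h.
by rewrite (bigD1 i)//= lerDl sumr_ge0// => k _; exact: sqr_ge0.
Qed.

(** Induction on the length. During the last letter, the trajectory for [t'] is compared with the
    one for [t] run for the duration [t' l]: Gronwall bounds their distance by that of the previous
    states, and the second trajectory is continuous in its duration. *)
Lemma state_word_continuous a t l i :
  word_value x a t' l i 0 @[t' --> word_nbhs t l] --> word_value x a t l i 0.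
Proof.
have [K KP] := state_gronwall.
elim: l i => [|l IH] i.
  have -> : (fun t' => word_value x a t' 0 i 0) = cst (word_value x a t 0 i 0).
    apply/funext => t'; rewrite /cst; congr ((_ : 'cV[R]_n) i 0).
    by apply: eq_word_value => //; exact: state_strictly_causal.
  exact: cvg_cst.
have wn : word_nbhs t l.+1 `=>` word_nbhs t l.
  by move=> A [e /= e0 eA]; exists e => //= t' h; apply: eA => j jl; apply: h; exact: ltnW.
have last t' : word_value x a t' l.+1 i 0 =
    ext (fun s => x (word_input a t' l) s i 0) ((elapsed t' l)%:num + (t' l)%:num).
  rewrite -elapsedS ext_num; congr ((_ : 'cV[R]_n) i 0); apply/esym.
  apply: follows_value; first exact: state_strictly_causal.
  move=> j tau; rewrite ltnS leq_eqVlt => /predU1P[->|jl] /andP[h1 h2].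
    exact: word_input_last.
  by apply: (@word_input_follows _ _ _ a t' l j tau jl); rewrite h1.
pose y s := ext (fun s => x (word_input a t l) s i 0) ((elapsed t l)%:num + s).
have cy : continuous y.
  move=> s; apply: continuous_comp; last exact: state_continuous.
  by apply: cvgD; [exact: cvg_cst|exact: cvg_id].
have y_cvg : y (t' l)%:num @[t' --> word_nbhs t l.+1] --> y (t l)%:num.
  exact: cvg_comp (cvg_word_time (ltnSn l)) (cy _).
pose D t' := \sum_j (word_value x a t' l j 0 - word_value x a t l j 0) ^+ 2.
have D_cvg : expR (K * (t' l)%:num) * D t' @[t' --> word_nbhs t l.+1] --> expR (K * (t l)%:num) * 0.
  have K_cvg : K * (t' l)%:num @[t' --> word_nbhs t l.+1] --> K * (t l)%:num.
    by apply: cvgM; [exact: cvg_cst|exact: cvg_word_time].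
  apply: cvgM; first exact: (cvg_comp _ _ K_cvg (@continuous_expR R _)).
  apply: (cvg_trans (cvg_app D wn)).
  rewrite (_ : 0 = \sum_(j < n) (0 : R)); last by rewrite big1.
  rewrite /D; apply: cvg_big => [|j _]; first exact: add_continuous.
  have sub_cvg : word_value x a t' l j 0 - word_value x a t l j 0 @[t' --> word_nbhs t l] --> 0.
    by rewrite -(subrr (word_value x a t l j 0)); apply: cvgB; [exact: IH|exact: cvg_cst].
  by have := cvg_comp _ _ sub_cvg (@exprn_continuous R 2 _); rewrite expr0n.
rewrite mulr0 in D_cvg.
have dist t' : `|word_value x a t' l.+1 i 0 - y (t' l)%:num| ^+ 2 <= expR (K * (t' l)%:num) * D t'.
  rewrite last real_normK ?num_real//.
  have := KP (word_input a t' l) (word_input a t l) (elapsed t' l) (elapsed t l) (t' l).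
  have h s : 0 <= s < (t' l)%:num -> ext (word_input a t' l) ((elapsed t' l)%:num + s) =
     ext (word_input a t l) ((elapsed t l)%:num + s).
    move=> /andP[s0 _]; have e1 : 0 <= (elapsed t' l)%:num + s by rewrite addr_ge0.
    have e2 : 0 <= (elapsed t l)%:num + s by rewrite addr_ge0.
    by rewrite (ext_ge0 _ e1) (ext_ge0 _ e2) !word_input_last//= lerDl.
  move=> /(_ h); apply: le_trans; rewrite (bigD1 i)//= lerDl sumr_ge0// => j _.
  exact: sqr_ge0.
have diff0 : word_value x a t' l.+1 i 0 - y (t' l)%:num @[t' --> word_nbhs t l.+1] --> 0.
  apply/cvgr0Pnorm_lt => e e0.
  have e20 : 0 < e ^+ 2 by rewrite exprn_gt0.
  have /cvgr0Pnorm_lt/(_ _ e20) := D_cvg; apply: filterS => t' h.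
  rewrite -(@ltr_pXn2r _ 2)// ?nnegrE ?ltW//.
  apply: le_lt_trans (dist t') _; apply: le_lt_trans h; exact: ler_norm.
rewrite (last t) -[ext _ _]/(y (t l)%:num) -[y _]add0r.
by apply: (eq_cvg_at _ (cvgD diff0 y_cvg)) => t'; rewrite fctE subrK.
Qed.
End State.

(** * Analytic functions *)

Section Analytic.
Variable R : realType.
Implicit Types (f g : R -> R) (a b s h : R).

(** Relative to the closed interval, with one-sided expansions at its ends: segments of durations
    may touch the boundary of the orthant. *)
Definition analytic_on a b f : Prop := forall s, a <= s <= b ->
  exists c : nat -> R, exists2 r : R, 0 < r &
    forall x, a <= x <= b -> `|x - s| < r -> pseries c (x - s) @ \oo --> f x.

Lemma real_analytic_on a b f : real_analytic f -> analytic_on a b f.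
Proof. by move=> fa s _; have [c [r r0 rP]] := fa s; exists c, r => // x _; exact: rP. Qed.

Lemma pseriesE (c : nat -> R) h n : pseries c h n = \sum_(i < n) c i * h ^+ i.
Proof. by rewrite /pseries /series /= big_mkord. Qed.

Lemma exists_near_point a b s (r : R) : a < b -> a <= s <= b -> 0 < r ->
  exists x, [/\ a <= x <= b, x != s & `|x - s| < r].
Proof.
move=> ab /andP[as_ sb] r0; have [sltb|] := ltP s b.
  exists (Num.min b (s + r / 2)).
  have h1 : s < Num.min b (s + r / 2) by rewrite lt_min sltb ltrDl divr_gt0.
  split; first by rewrite (le_trans as_ (ltW h1)) ge_min lexx.
    by rewrite gt_eqF.
  rewrite gtr0_norm ?subr_gt0// ltrBlDl gt_min; apply/orP; right; lra.
move=> bs; have E : s = b by apply/le_anti; rewrite sb.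
exists (Num.max a (s - r / 2)).
have h1 : Num.max a (s - r / 2) < s by rewrite gt_max {1}E ab; lra.
split; first by rewrite le_max lexx /= -E ltW.
  by rewrite lt_eqF.
rewrite distrC gtr0_norm ?subr_gt0// ltrBlDr -ltrBlDl lt_max; apply/orP; right; lra.
Qed.

Lemma sum_half_le (n : nat) : \sum_(i < n) (2^-1 : R) ^+ i <= 2.
Proof.
have : \sum_(i < n) (2^-1 : R) ^+ i = 2 - 2 * 2^-1 ^+ n.
  elim: n => [|n IH]; first by rewrite big_ord0 expr0; lra.
  by rewrite big_ord_recr /= IH exprS; lra.
by move=> ->; rewrite lerBlDr lerDl mulr_ge0// exprn_ge0.
Qed.

Lemma cvg_pseries_coef_le (c : nat -> R) h (l : R) : h != 0 ->
  pseries c h @ \oo --> l -> exists2 C, 0 <= C & forall n, `|c n| * `|h| ^+ n <= C.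
Proof.
move=> h0 /cvgP/cvg_series_cvg_0 H.
have [C [_ CP]] := cvg_seq_bounded (cvgP _ H).
exists (`|C| + 1); first by rewrite addr_ge0.
move=> n; rewrite -normrX -normrM; apply: (CP (`|C| + 1)) => //.
by rewrite (le_lt_trans (ler_norm C))// ltrDl.
Qed.

(** The terms are dominated by [C * q ^+ i] with [q = |h| / rho] at most 1/2; the geometric series
    accounts for the factor 2. *)
Lemma pseries_remainder (c : nat -> R) (rho C h l : R) (k : nat) : 0 < rho -> 0 <= C ->
  (forall n, `|c n| * rho ^+ n <= C) -> `|h| <= rho / 2 -> pseries c h @ \oo --> l ->
  `|l - \sum_(i < k) c i * h ^+ i| <= 2 * C * (`|h| / rho) ^+ k.
Proof.
move=> rho0 C0 cC hrho cl; set S := \sum_(i < k) _; set q := `|h| / rho.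
have q0 : 0 <= q by rewrite divr_ge0// ltW.
have q2 : q <= 2^-1 by rewrite ler_pdivrMr// mulrC.
have term i : `|c i * h ^+ i| <= C * q ^+ i.
  rewrite normrM normrX.
  have -> : `|h| = rho * q by rewrite mulrC divfK// gt_eqF.
  by rewrite exprMn mulrA ler_wpM2r// exprn_ge0.
have lim : (fun n => `|pseries c h n - S|) @ \oo --> `|l - S|.
  by apply: cvg_norm; apply: cvgB => //; exact: cvg_cst.
apply: (@closed_cvg _ _ _ _ _ [set y | y <= 2 * C * q ^+ k] (@closed_le _ _) _ _ lim).
exists k => // n /= kn; have [j ->] : exists j, n = (k + j)%N.
  by exists (n - k)%N; rewrite subnKC.
rewrite pseriesE big_split_ord /= [X in X + _ - S](_ : _ = S)// addrAC subrr add0r.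
apply: le_trans (ler_norm_sum _ _ _) _.
apply: le_trans (_ : \sum_(i < j) C * q ^+ k * 2^-1 ^+ i <= _).
  apply: ler_sum => i _; apply: le_trans (term _) _.
  rewrite exprD -mulrA ler_wpM2l// ler_wpM2l ?exprn_ge0//.
  by rewrite lerXn2r// nnegrE.
rewrite -mulr_sumr [leRHS](_ : _ = C * q ^+ k * 2); last by ring.
by rewrite ler_wpM2l ?sum_half_le// mulr_ge0// exprn_ge0.
Qed.

(** Either all coefficients vanish, or the first nonzero one, [c k], outweighs the remainder of
    order [k.+1] close to [s]. *)
Lemma analytic_on_zero a b f s : a < b -> a <= s <= b -> analytic_on a b f ->
  (exists2 r, 0 < r & forall x, a <= x <= b -> `|x - s| < r -> f x = 0) \/
  (exists2 r, 0 < r & forall x, a <= x <= b -> 0 < `|x - s| < r -> f x != 0).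
Proof.
move=> ab sab fan; have [c [r r0 rP]] := fan s sab.
have [x0 [x0ab x0s x0r]] := exists_near_point ab sab r0.
set rho := `|x0 - s|; have rho0 : 0 < rho by rewrite normr_gt0 subr_eq0.
have [C C0 cC] : exists2 C, 0 <= C & forall n, `|c n| * rho ^+ n <= C.
  by apply: cvg_pseries_coef_le (rP _ x0ab x0r); rewrite subr_eq0.
have [c0|] := pselect (forall n, c n = 0).
  left; exists r => // x xab xr; have := rP x xab xr.
  have -> : pseries c (x - s) = (fun=> 0).
    by apply/funext => n; rewrite pseriesE big1// => i _; rewrite c0 mul0r.
  by move=> H; exact: (cvg_unique _ H (cvg_cst 0)).
move=> /existsNP[n0 cn0]; right.
have exc : exists n, c n != 0 by exists n0; exact/eqP.
pose k := ex_minn exc.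
have ck : c k != 0 by rewrite /k; case: ex_minnP.
have cltk i : (i < k)%N -> c i = 0.
  rewrite /k; case: ex_minnP => j _ jmin ij; apply/eqP; apply: contraTT ij => ci.
  by rewrite -leqNgt jmin.
pose C' := 2 * C / rho ^+ k.+1.
have C'0 : 0 <= C' by rewrite divr_ge0 ?mulr_ge0// exprn_ge0// ltW.
pose r1 := Num.min (rho / 2) (`|c k| / (C' + 1)).
have C'1 : 0 < C' + 1 by rewrite ltr_wpDl.
exists (Num.min r r1).
  by rewrite !lt_min r0 !divr_gt0// normr_gt0.
move=> x xab /andP[xs]; rewrite !lt_min => /and3P[xr xrho xc].
have := pseries_remainder k.+1 rho0 C0 cC (ltW xrho) (rP x xab xr).
rewrite big_ord_recr /= big1 ?add0r => [|i _]; last by rewrite cltk// mul0r.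
rewrite expr_div_n mulrA => H; apply/eqP => fx0; move: H.
rewrite fx0 sub0r normrN normrM normrX exprSr mulrA mulrAC.
rewrite [X in _ <= X](_ : _ = `|x - s| ^+ k * (C' * `|x - s|)); last by rewrite /C'; ring.
rewrite mulrC ler_pM2l ?exprn_gt0// leNgt => /negP; apply.
move: xc; rewrite ltr_pdivlMr// mulrC mulrDl mul1r; lra.
Qed.

(** Real induction: vanishing on the left of [s] excludes the isolated-zero alternative at [s], so
    [f] vanishes at [s] and on its right too. *)
Lemma analytic_on_identity a b f : a < b -> analytic_on a b f ->
  (exists2 r, 0 < r & forall x, a <= x < a + r -> x <= b -> f x = 0) ->
  forall x, a <= x <= b -> f x = 0.
Proof.
move=> ab fan [r0 r00 r0P].
have left_zero s : a < s <= b -> (forall x, a <= x < s -> f x = 0) ->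
    exists2 r, 0 < r & forall x, a <= x <= b -> `|x - s| < r -> f x = 0.
  move=> /andP[as_ sb] H; have sab : a <= s <= b by rewrite ltW.
  have [//|[r r_0 rP]] := analytic_on_zero ab sab fan.
  pose x := Num.max a (s - r / 2).
  have ax : a <= x by rewrite le_max lexx.
  have xs : x < s by rewrite gt_max as_; lra.
  have rx : s - r < x by rewrite lt_max; apply/orP; right; lra.
  have := rP x; rewrite ax (le_trans (ltW xs) sb) distrC gtr0_norm ?subr_gt0//.
  rewrite xs ltrBlDr -ltrBlDl => /(_ isT); rewrite rx => /(_ isT)/eqP; case.
  by apply: H; rewrite ax.
apply: real_induction.
- by apply: r0P; rewrite ?lexx ?ltrDl// ltW.
- move=> s /andP[as_ sb] fs; move: as_; rewrite le_eqVlt => /predU1P[<-|as_].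
    exists r0 => // x /andP[sx xr] xb; apply: r0P => //; by rewrite ltW.
  have [|x /andP[ax xs]|r r_0 rP] := left_zero s; first by rewrite as_ ltW.
    by apply: fs; rewrite ax ltW.
  exists r => // x /andP[sx xr] xb; apply: rP.
    by rewrite xb andbT ltW// (lt_trans as_).
  by rewrite gtr0_norm ?subr_gt0// ltrBlDl.
- move=> s sab fs; have [r r_0 rP] := left_zero s sab fs.
  by apply: rP; rewrite ?subrr ?normr0//; case/andP: sab => /ltW ->.
Qed.

Lemma analytic_onD a b f g : analytic_on a b f -> analytic_on a b g ->
  analytic_on a b (fun x => f x + g x).
Proof.
move=> fan gan s sab; have [c [r r0 rP]] := fan s sab; have [d [r' r'0 r'P]] := gan s sab.
exists (fun n => c n + d n), (Num.min r r'); first by rewrite lt_min r0.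
move=> x xab; rewrite lt_min => /andP[xr xr'].
apply: (eq_cvg_at _ (cvgD (rP x xab xr) (r'P x xab xr'))) => n.
rewrite fctE !pseriesE -big_split /=; apply: eq_bigr => i _; by rewrite mulrDl.
Qed.

Lemma analytic_on_cst a b (k : R) : analytic_on a b (fun=> k).
Proof.
move=> s _; exists (fun n => if n is 0%N then k else 0), 1 => // x _ _.
apply: (@near_cvg_at R _ _ _ (fun=> k)); last exact: cvg_cst.
exists 1%N => // -[//|n] _; rewrite pseriesE big_ord_recl /= mulr1 big1 ?addr0//.
by move=> i _; rewrite mul0r.
Qed.

(** The product of the truncations at [n], as polynomials, has the Cauchy coefficients below degree
    [n]. Its term of degree [k] is at most [k.+1 * C ^+ 2 * q ^+ k]; as [k.+1 <= 2 ^ k], taking [q]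
    at most 1/4 leaves a geometric tail of ratio 1/2. *)
Lemma cvg_pseries_mul (c d : nat -> R) (rho C h l l' : R) : 0 < rho -> 0 <= C ->
  (forall n, `|c n| * rho ^+ n <= C) -> (forall n, `|d n| * rho ^+ n <= C) ->
  `|h| <= rho / 4 -> pseries c h @ \oo --> l -> pseries d h @ \oo --> l' ->
  pseries (fun n => \sum_(i < n.+1) c i * d (n - i)%N) h @ \oo --> l * l'.
Proof.
move=> rho0 C0 cC dC hrho cl dl; set q := `|h| / rho.
have q0 : 0 <= q by rewrite divr_ge0// ltW.
have q4 : q <= 2^-1 * 2^-1 by rewrite -invfM ler_pdivrMr// -natrM mulrC.
have hq : `|h| = rho * q by rewrite mulrC divfK// gt_eqF.
have term (e : nat -> R) i : (forall n, `|e n| * rho ^+ n <= C) -> `|e i * h ^+ i| <= C * q ^+ i.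
  by move=> eC; rewrite normrM normrX hq exprMn mulrA ler_wpM2r// exprn_ge0.
pose e n := \sum_(i < n.+1) c i * d (n - i)%N.
pose pc n := \poly_(i < n) c i; pose pd n := \poly_(i < n) d i.
have pcE n : pseries c h n = (pc n).[h].
  rewrite pseriesE (horner_coef_wide _ (size_poly _ _)); apply: eq_bigr => i _.
  by rewrite coef_poly ltn_ord.
have pdE n : pseries d h n = (pd n).[h].
  rewrite pseriesE (horner_coef_wide _ (size_poly _ _)); apply: eq_bigr => i _.
  by rewrite coef_poly ltn_ord.
have coefB n k : `|(pc n * pd n)`_k * h ^+ k| <= C ^+ 2 * 2^-1 ^+ k.
  rewrite coefM mulr_suml; apply: le_trans (ler_norm_sum _ _ _) _.
  apply: le_trans (_ : \sum_(i < k.+1) C ^+ 2 * q ^+ k <= _).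
    apply: ler_sum => i _; have ik : (i <= k)%N by rewrite -ltnS.
    have split_exp (y : R) : y ^+ k = y ^+ i * y ^+ (k - i) by rewrite -exprD subnKC.
    rewrite !split_exp mulrACA normrM expr2 mulrACA.
    apply: ler_pM => //.
      rewrite coef_poly; case: ifP => _; first exact: term.
      by rewrite mul0r normr0 mulr_ge0// exprn_ge0.
    rewrite coef_poly; case: ifP => _; first exact: term.
    by rewrite mul0r normr0 mulr_ge0// exprn_ge0.
  rewrite sumr_const card_ord -mulrnAr ler_wpM2l ?exprn_ge0//.
  apply: le_trans (_ : (2 * q) ^+ k <= _); last first.
    have q2 : 2 * q <= 2^-1 by move: q4; lra.
    by apply: lerXn2r; rewrite ?nnegrE ?mulr_ge0 ?invr_ge0 // ltW.
  rewrite [(2 * q) ^+ k]exprMn -[leLHS]mulr_natl ler_wpM2r ?exprn_ge0//.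
  by rewrite -natrX ler_nat ltn_expl.
suff H : (fun n => pseries c h n * pseries d h n - pseries e h n) @ \oo --> 0.
  rewrite -[l * l']subr0; apply: (eq_cvg_at _ (cvgB (cvgM cl dl) H)) => n.
  by rewrite fctE /GRing.mul_fun opprB addrC subrK.
have geo : (fun n => 2 * C ^+ 2 * 2^-1 ^+ n) @ \oo --> (0 : R).
  rewrite -(mulr0 (2 * C ^+ 2)); apply: cvgM; first exact: cvg_cst.
  by apply: cvg_expr; rewrite gtr0_norm// invf_lt1// ltr1n.
apply/norm_cvg0P; apply: (@squeeze_cvgr _ _ _ _ (cst 0) _ _ _ _ (cvg_cst _) geo).
apply: filterE => n; rewrite normr_ge0 /=.
rewrite pcE pdE -hornerM (@horner_coef_wide _ (n + n)); last first.
  apply: leq_trans (size_polyMleq _ _) _; rewrite (leq_trans (leq_pred _))//.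
  by rewrite leq_add// size_poly.
rewrite big_split_ord /= [X in X + _ - _](_ : _ = pseries e h n); last first.
  rewrite pseriesE; apply: eq_bigr => i _; congr (_ * _); rewrite coefM /e.
  apply: eq_bigr => k _; rewrite !coef_poly.
  have kn : (k < n)%N by apply: leq_ltn_trans (ltn_ord i); rewrite -ltnS.
  by rewrite kn (leq_ltn_trans (leq_subr k i) (ltn_ord i)).
rewrite addrAC subrr add0r; apply: le_trans (ler_norm_sum _ _ _) _.
apply: le_trans (_ : \sum_(i < n) C ^+ 2 * 2^-1 ^+ n * 2^-1 ^+ i <= _).
  by apply: ler_sum => i _; apply: le_trans (coefB _ _) _; rewrite exprD mulrA.
rewrite -mulr_sumr [leRHS](_ : _ = C ^+ 2 * 2^-1 ^+ n * 2); last by ring.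
by rewrite ler_wpM2l ?sum_half_le// mulr_ge0// exprn_ge0.
Qed.

Lemma analytic_onM a b f g : a < b -> analytic_on a b f -> analytic_on a b g ->
  analytic_on a b (fun x => f x * g x).
Proof.
move=> ab fan gan s sab; have [c [r r0 rP]] := fan s sab; have [d [r' r'0 r'P]] := gan s sab.
have m0 : 0 < Num.min r r' by rewrite lt_min r0.
have [x0 [x0ab x0s]] := exists_near_point ab sab m0; rewrite lt_min => /andP[x0r x0r'].
set rho := `|x0 - s|; have rho0 : 0 < rho by rewrite normr_gt0 subr_eq0.
have x0s' : x0 - s != 0 by rewrite subr_eq0.
have [C C0 cC] := cvg_pseries_coef_le x0s' (rP _ x0ab x0r).
have [C' C'0 dC'] := cvg_pseries_coef_le x0s' (r'P _ x0ab x0r').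
exists (fun n => \sum_(i < n.+1) c i * d (n - i)%N), (Num.min (Num.min r r') (rho / 4)).
  by rewrite lt_min m0 divr_gt0.
move=> x xab; rewrite !lt_min => /andP[/andP[xr xr'] xrho].
apply: (@cvg_pseries_mul c d rho (C + C')) => //.
- exact: addr_ge0.
- by move=> n; apply: le_trans (cC n) _; rewrite lerDl.
- by move=> n; apply: le_trans (dC' n) _; rewrite lerDr.
- exact: ltW.
- exact: rP.
- exact: r'P.
Qed.

Lemma real_analytic_derivable f s : real_analytic f -> derivable f s 1.
Proof.
move=> fan; have [c [r r0 rP]] := fan s.
have r20 : r / 2 != 0 by rewrite gt_eqF// divr_gt0.
have nr : `|r / 2| = r / 2 by rewrite gtr0_norm// divr_gt0.
have fr : pseries c (r / 2) @ \oo --> f (s + r / 2).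
  have := rP (s + r / 2); rewrite addrAC subrr add0r; apply.
  by rewrite nr; lra.
have [C C0 cC] := cvg_pseries_coef_le r20 fr; rewrite nr in cC.
have rho0 : 0 < r / 2 by rewrite divr_gt0.
have rem h k : `|h| <= r / 2 / 2 ->
   `|f (s + h) - \sum_(i < k) c i * h ^+ i| <= 2 * C * (`|h| / (r / 2)) ^+ k.
  move=> hr; apply: (pseries_remainder k rho0 C0 cC hr).
  have := rP (s + h); rewrite addrAC subrr add0r; apply.
  by apply: le_lt_trans hr _; lra.
have fs : f s = c 0%N.
  have := rem 0 1%N; rewrite addr0 normr0 mul0r expr1 mulr0 big_ord1 expr0 mulr1.
  by move=> /(_ ltac:(lra)); rewrite normr_le0 subr_eq0 => /eqP.
apply/cvg_ex; exists (c 1%N).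
pose D := 2 * C / (r / 2) ^+ 2.
have D0 : 0 <= D by apply: divr_ge0; [exact: mulr_ge0|exact: sqr_ge0].
apply/cvgrPdist_lt => e e0.
have D1 : 0 < D + 1 by rewrite ltr_wpDl.
apply/nbhs_ballP; exists (Num.min (r / 2 / 2) (e / (D + 1))) => /=.
  by rewrite lt_min !divr_gt0.
move=> h; rewrite /ball /= sub0r normrN lt_min => /andP[hr he] h0.
rewrite scaler1 distrC fs /GRing.scale /=.
have := rem h 2%N (ltW hr); rewrite !big_ord_recr big_ord0 /= add0r expr0 mulr1 expr1.
have -> : h^-1 * (f (h + s) - c 0%N) - c 1%N = h^-1 * (f (s + h) - (c 0%N + c 1%N * h)).
  by rewrite [s + h]addrC; field.
rewrite normrM normrV ?unitfE// expr_div_n mulrA => H.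
have hp : 0 < `|h| by rewrite normr_gt0.
rewrite mulrC ltr_pdivrMr//; apply: le_lt_trans H _.
rewrite [X in X < _](_ : _ = D * `|h| * `|h|); last by rewrite /D; ring.
rewrite ltr_pM2r//; move: he; rewrite ltr_pdivlMr// mulrC mulrDl mul1r.
by have := mulr_ge0 D0 (ltW hp); lra.
Qed.

Lemma real_analytic_affine f k0 k1 : real_analytic f ->
  real_analytic (fun x => f (k0 + k1 * x)).
Proof.
move=> fan s; have [c [r r0 rP]] := fan (k0 + k1 * s).
exists (fun n => c n * k1 ^+ n), (r / (`|k1| + 1)).
  by rewrite divr_gt0// ltr_wpDl.
move=> x xr; have := rP (k0 + k1 * x).
rewrite opprD addrACA subrr add0r -mulrBr normrM => H.
have -> : pseries (fun n => c n * k1 ^+ n) (x - s) = pseries c (k1 * (x - s)).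
  by apply/funext => n; rewrite !pseriesE; apply: eq_bigr => i _; rewrite exprMn mulrA.
apply: H; apply: le_lt_trans (_ : (`|k1| + 1) * `|x - s| < _).
  by rewrite ler_wpM2r// lerDl.
by rewrite mulrC -ltr_pdivlMr// ltr_wpDl.
Qed.
End Analytic.

(** * Polynomials in analytic functions and isolated zeros *)

Section Meval.
Variables (R : realType) (X : Type) (N : nat).

(** [Cl] is left abstract to serve for analyticity on the line as well as for rationality and
    derivability of germs. *)
Lemma meval_closed (Cl : (X -> R) -> Prop) (g : 'I_N -> X -> R) :
  (forall c, Cl (fun=> c)) ->
  (forall f h, Cl f -> Cl h -> Cl (fun x => f x + h x)) ->
  (forall f h, Cl f -> Cl h -> Cl (fun x => f x * h x)) ->
  (forall i, Cl (g i)) ->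
  forall P : mpoly.mpoly N R, Cl (fun x => mpoly.meval (g^~ x) P).
Proof.
move=> Cc CD CM Cg P.
have CX f k : Cl f -> Cl (fun x => f x ^+ k).
  move=> Cf; elim: k => [|k IH]; first exact: Cc.
  have -> : (fun x => f x ^+ k.+1) = (fun x => f x * f x ^+ k).
    by apply/funext => x; rewrite exprS.
  exact: CM.
have Csum (I : Type) (r : seq I) (f : I -> X -> R) : (forall i, Cl (f i)) ->
    Cl (fun x => \sum_(i <- r) f i x).
  move=> Cf; elim: r => [|i r IH].
    by under eq_fun do rewrite big_nil; exact: Cc.
  by under eq_fun do rewrite big_cons; exact: CD.
have Cprod (I : Type) (r : seq I) (f : I -> X -> R) : (forall i, Cl (f i)) ->
    Cl (fun x => \prod_(i <- r) f i x).
  move=> Cf; elim: r => [|i r IH].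
    by under eq_fun do rewrite big_nil; exact: Cc.
  by under eq_fun do rewrite big_cons; exact: CM.
under eq_fun do rewrite mpoly.mevalE.
apply: (Csum _ _ (fun mm x => mpoly.mcoeff mm P * \prod_i g i x ^+ mm i)) => mm.
apply: CM; first exact: Cc.
by apply: (Cprod _ _ (fun i x => g i x ^+ mm i)) => i; exact: CX.
Qed.
End Meval.

Section RealAnalytic.
Variable R : realType.

Lemma real_analyticP (f : R -> R) :
  real_analytic f <-> (forall a b, a < b -> analytic_on a b f).
Proof.
split=> [fan a b _|fan s]; first exact: real_analytic_on.
have [||c [r r0 rP]] := fan (s - 1) (s + 1) _ s; [by lra|by apply/andP; split; lra|].
exists c, (Num.min r 1); first by rewrite lt_min r0 ltr01.
move=> x; rewrite lt_min => /andP[xr]; rewrite ltr_distl => /andP[h1 h2].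
by apply: rP => //; rewrite !ltW.
Qed.

Lemma real_analytic_meval (N : nat) (xi : 'I_N -> R -> R) (P : mpoly.mpoly N R) :
  (forall i, real_analytic (xi i)) ->
  real_analytic (fun x => mpoly.meval (xi^~ x) P).
Proof.
move=> xian; apply: meval_closed => //.
- by move=> c; apply/real_analyticP => a b _; exact: analytic_on_cst.
- move=> f h /real_analyticP fa /real_analyticP ha; apply/real_analyticP => a b ab.
  by apply: analytic_onD; [exact: fa|exact: ha].
- move=> f h /real_analyticP fa /real_analyticP ha; apply/real_analyticP => a b ab.
  by apply: analytic_onM => //; [exact: fa|exact: ha].
Qed.

(** If [f] vanished near [s], the identity theorem on the segment from [s] to a point [b] with
    [f b != 0] would be contradicted. Rescaling this segment to [[0, 1]] treats both positions of
    [b] at once. *)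
Lemma real_analytic_isolated_zero (f : R -> R) (s : R) : real_analytic f ->
  (exists x, f x != 0) ->
  exists2 r, 0 < r & forall x, 0 < `|x - s| < r -> f x != 0.
Proof.
move=> fan [b fb].
have ss : s - 1 < s + 1 by lra.
have sss : s - 1 <= s <= s + 1 by apply/andP; split; lra.
case: (analytic_on_zero ss sss (real_analytic_on fan)) => [[r r0 rP]|[r r0 rP]].
  pose g x := f (s + (b - s) * x).
  have gan : real_analytic g := real_analytic_affine s (b - s) fan.
  have := analytic_on_identity ltr01 (real_analytic_on (a := 0) (b := 1) gan).
  have d0 : 0 < `|b - s| + 1 by rewrite ltr_wpDl.
  have H : exists2 r, 0 < r & forall x, 0 <= x < 0 + r -> x <= 1 -> g x = 0.
    exists (Num.min r 1 / (`|b - s| + 1)); first by rewrite divr_gt0// lt_min r0 ltr01.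
    move=> x; rewrite add0r ltr_pdivlMr// => /andP[x0 xr] _.
    have bx : `|(b - s) * x| < Num.min r 1.
      apply: le_lt_trans xr; rewrite normrM (ger0_norm x0) mulrC ler_wpM2l//.
      by rewrite lerDl.
    move: bx; rewrite lt_min => /andP[bx1 /ltr_normlP[bx2 bx3]].
    apply: rP; last by rewrite addrAC subrr add0r.
    by apply/andP; split; lra.
  move=> /(_ H 1); rewrite ler01 lexx => /(_ isT).
  by rewrite /g mulr1 addrC subrK => /eqP; rewrite (negbTE fb).
exists (Num.min r 1); first by rewrite lt_min r0 ltr01.
move=> x /andP[x0]; rewrite lt_min => /andP[xr]; rewrite ltr_distl => /andP[h1 h2].
by apply: rP; rewrite ?x0// !ltW.
Qed.
End RealAnalytic.

(** * Restricting analytic functions on the orthant to segments *)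

Section Segment.
Variables (R : realType) (l : nat).
Implicit Types a b : 'I_l -> time R.

Definition segment a b (s : R) : 'I_l -> time R :=
  fun i => NngNum (max0r_ge0 ((a i)%:num + s * ((b i)%:num - (a i)%:num))).

Lemma segmentE a b s i : 0 <= s <= 1 ->
  (segment a b s i)%:num = (a i)%:num + s * ((b i)%:num - (a i)%:num).
Proof.
move=> /andP[s0 s1] /=; rewrite max_r//.
rewrite mulrBr addrCA -[X in _ + (X - _)]mul1r -mulrBl addr_ge0// mulr_ge0//.
by rewrite subr_ge0.
Qed.

Lemma segment1 a b : segment a b 1 = b.
Proof. by apply/funext => i; apply/val_inj; rewrite /= mul1r addrC subrK max_r. Qed.

(** Summing the unconditional series along these finite sets groups it by total degree, which is
    what turns it into a power series in one variable. *)
Definition degree_lt (n : nat) : {fset {ffun 'I_l -> nat}} :=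
  seq_fset tt [seq k <- [seq [ffun i => val (f i)] | f : {ffun 'I_l -> 'I_n}] |
                 (\sum_i (k : {ffun 'I_l -> nat}) i < n)%N].

Lemma in_degree_lt n (k : {ffun 'I_l -> nat}) : (k \in degree_lt n) = (\sum_i k i < n)%N.
Proof.
rewrite seq_fsetE mem_filter; case: ltnP => //= kn.
have ki i : (k i < n)%N by apply: leq_ltn_trans kn; rewrite (bigD1 i)//= leq_addr.
apply/mapP; exists [ffun i => Ordinal (ki i)]; first by rewrite mem_enum.
by apply/ffunP => i; rewrite !ffunE.
Qed.

Lemma degree_lt_totally : degree_lt @ \oo --> totally.
Proof.
move=> A [B _ BA]; exists (\sum_(k <- B) \sum_i k i).+1 => // n /= nB.
apply: BA => /=; apply/fsubsetP => k kB; rewrite in_degree_lt.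
apply: leq_trans nB; rewrite ltnS (big_rem k)//= leq_addr//.
Qed.

(** Increments along the segment are [(s - s0) * v i], so the terms of total degree [n] add up to
    [e n * (s - s0) ^+ n]. *)
Lemma orthant_analytic_segment (F : ('I_l -> time R) -> R) a b :
  orthant_analytic F -> analytic_on 0 1 (fun s => F (segment a b s)).
Proof.
move=> Fan s0 s01; have [c [r r0 rP]] := Fan (segment a b s0).
pose v i := (b i)%:num - (a i)%:num.
pose M := \sum_i `|v i| + 1.
have M0 : 0 < M by rewrite ltr_wpDl// sumr_ge0.
pose w (k : {ffun 'I_l -> nat}) := c k * \prod_i v i ^+ k i.
pose e n := partial_sum w (degree_lt n.+1) - partial_sum w (degree_lt n).
exists e, (r / M); first by rewrite divr_gt0.
move=> s sab sr.
have diffE i : (segment a b s i)%:num - (segment a b s0 i)%:num = (s - s0) * v i.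
  by rewrite !segmentE// opprD addrACA subrr add0r -mulrBl.
have near_i i : `|(segment a b s i)%:num - (segment a b s0 i)%:num| < r.
  rewrite diffE normrM; apply: le_lt_trans (_ : `|s - s0| * M < _).
    by rewrite ler_wpM2l// /M (bigD1 i)//= -addrA lerDl addr_ge0// sumr_ge0.
  by rewrite -ltr_pdivlMr.
have := cvg_comp _ _ degree_lt_totally (rP _ near_i).
apply: eq_cvg_at => n; rewrite /comp; elim: n => [|n IH].
  rewrite pseriesE big_ord0 /partial_sum big1// => -[k /= kd] _.
  by have := kd; rewrite in_degree_lt.
have psE (y : {ffun 'I_l -> nat} -> R) A : partial_sum y A = \sum_(k <- A) y k.
  by rewrite /partial_sum big_seq_fsetE.
pose top := [fset k in degree_lt n.+1 | ~~ (\sum_i k i < n)%N]%fset.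
have step (y : {ffun 'I_l -> nat} -> R) : partial_sum y (degree_lt n.+1) =
    partial_sum y (degree_lt n) + \sum_(k <- top) y k.
  rewrite !psE (big_fsetID _ (fun k : {ffun 'I_l -> nat} => (\sum_i k i < n)%N)).
  congr (_ + _); apply: eq_fbigl => k; rewrite !inE /= !in_degree_lt.
  by apply/andP/idP => [[]//|kn]; split => //; exact: ltnW.
rewrite step IH !pseriesE big_ord_recr /=; congr (_ + _).
rewrite /e step addrAC subrr add0r mulr_suml !big_seq; apply: eq_bigr => k.
rewrite !inE /= in_degree_lt -leqNgt ltnS => /andP[k1 k2].
have -> : n = (\sum_i k i)%N by apply/eqP; rewrite eqn_leq k1 k2.
rewrite /w -mulrA; congr (_ * _); rewrite expr_sum -big_split /=.
by apply: eq_bigr => i _; rewrite diffE exprMn mulrC.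
Qed.
End Segment.

(** * Algebraic dependence by dimension counting *)

Section Counting.
Variables (F : fieldType) (D : nat).
Local Notation poly := (mpoly.mpoly D F).
Implicit Types p q : poly.

Lemma msize_mul_le p q a b : (mpoly.msize p <= a.+1)%N -> (mpoly.msize q <= b.+1)%N ->
  (mpoly.msize (p * q) <= (a + b).+1)%N.
Proof.
move=> pa qb; have [->|p0] := eqVneq p 0; first by rewrite mul0r mpoly.msize0.
have [->|q0] := eqVneq q 0; first by rewrite mulr0 mpoly.msize0.
rewrite mpoly.msizeM// -subn1 leq_subLR add1n -addSn -addnS; exact: leq_add.
Qed.

Lemma msize_exp_le p a k : (mpoly.msize p <= a.+1)%N ->
  (mpoly.msize (p ^+ k) <= (k * a).+1)%N.
Proof.
move=> pa; elim: k => [|k IH]; first by rewrite expr0 mpoly.msize1.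
by rewrite exprS mulSn; exact: msize_mul_le.
Qed.

Lemma msize_prod_le (I : finType) (f : I -> poly) a :
  (forall i, (mpoly.msize (f i) <= a.+1)%N) -> (mpoly.msize (\prod_i f i) <= (#|I| * a).+1)%N.
Proof.
move=> fa; have : (mpoly.msize (\prod_i f i) <= (\sum_(i : I) a).+1)%N.
  elim/big_ind2: _ => //; first by rewrite mpoly.msize1.
  by move=> ? ? ? ?; exact: msize_mul_le.
by rewrite sum_nat_const.
Qed.

Lemma short_fat_dependent (A B : finType) (M : A -> B -> F) : (#|B| < #|A|)%N ->
  exists2 v : A -> F, (exists a, v a != 0) & forall b, \sum_a v a * M a b = 0.
Proof.
move=> BA; pose X := \matrix_(i < #|A|, j < #|B|) M (enum_val i) (enum_val j).
have : kermx X != 0.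
  by rewrite kermx_eq0 /row_free ltn_eqF// (leq_ltn_trans (rank_leq_col _)).
move=> /rowV0Pn[v /sub_kermxP vX v0].
exists (fun a => v 0 (enum_rank a)).
  have /rV0Pn[i vi] := v0.
  by exists (enum_val i); rewrite enum_valK.
move=> b; have /rowP/(_ (enum_rank b)) := vX; rewrite !mxE => H; rewrite -[RHS]H.
rewrite (reindex (@enum_val A [in A])) /=; last exact/onW_bij/enum_val_bij.
by apply: eq_bigr => i _; rewrite !mxE enum_valK enum_rankK.
Qed.

(** An algebraic relation between the fractions [P i / Q i], with the denominators [Q i ^+ M]
    cleared. There are more products, one for each [k], than monomials that can occur in them. *)
Lemma rational_functions_dependent (e : nat) (P Q : 'I_e -> poly) : (D < e)%N ->
  exists M, exists2 c : {ffun 'I_e -> 'I_M.+1} -> F, (exists k, c k != 0) &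
    \sum_(k : {ffun 'I_e -> 'I_M.+1}) c k *: \prod_i (P i ^+ k i * Q i ^+ (M - k i)) = 0.
Proof.
move=> De.
pose d := \max_(i < e) (mpoly.msize (P i) + mpoly.msize (Q i))%N.
have dP i : (mpoly.msize (P i) <= d.+1)%N.
  by apply: leqW; apply: leq_trans (leq_bigmax i); exact: leq_addr.
have dQ i : (mpoly.msize (Q i) <= d.+1)%N.
  by apply: leqW; apply: leq_trans (leq_bigmax i); exact: leq_addl.
(* Monomials have exponents below [K], where [K <= (e * d).+1 * M.+1]. This [M] makes
   [K ^ D <= M * M.+1 ^ D], which is less than [M.+1 ^ D.+1], hence than the number [M.+1 ^ e] of
   products. *)
pose M := ((e * d).+1 ^ D)%N; exists M.
pose K := (e * (M * d)).+1.
pose H (k : {ffun 'I_e -> 'I_M.+1}) := \prod_i (P i ^+ k i * Q i ^+ (M - k i)).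
have HK k : (mpoly.msize (H k) <= K)%N.
  rewrite /K -[e in (e * _).+1]card_ord; apply: msize_prod_le => i.
  have kM : (k i <= M)%N by rewrite -ltnS.
  rewrite (_ : M * d = k i * d + (M - k i) * d)%N; last by rewrite -mulnDl subnKC.
  by apply: msize_mul_le; apply: msize_exp_le.
pose mon (b : {ffun 'I_D -> 'I_K}) : mpoly.multinom D := 
  mpoly.Multinom [tuple val (b i) | i < D].
have [|c c0 cP] := @short_fat_dependent {ffun 'I_e -> 'I_M.+1} {ffun 'I_D -> 'I_K}
    (fun k b => mpoly.mcoeff (mon b) (H k)).
  rewrite !card_ffun !card_ord.
  apply: leq_ltn_trans (_ : ((e * d).+1 * M.+1) ^ D < _)%N.
    have expn_le a1 a2 k : (a1 <= a2)%N -> (a1 ^ k <= a2 ^ k)%N.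
      by move=> a12; elim: k => // k IH; rewrite !expnS leq_mul.
    apply: expn_le; rewrite /K mulSn mulnS addSn ltnS addnA -mulnA [(d * M)%N]mulnC.
    exact: leq_addl.
  rewrite expnMn -/M (leq_trans (_ : _ < M.+1 ^ D.+1)%N)//.
    by rewrite expnS ltn_pmul2r ?expn_gt0.
  exact: leq_pexp2l.
exists c => //; apply/mpoly.mpolyP => mm; rewrite mpoly.mcoeff0 raddf_sum /=.
have [mmK|Kmm] := ltnP (mpoly.mdeg mm) K; last first.
  rewrite big1// => k _; rewrite mpoly.mcoeffZ mpoly.memN_msupp_eq0 ?mulr0//.
  apply: mpoly.msize_mdeg_ge; exact: leq_trans (HK k) Kmm.
have mmi i : (mm i < K)%N.
  by apply: leq_ltn_trans mmK; rewrite mpoly.mdegE (bigD1 i)//= leq_addr.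
have <- : mon [ffun i => Ordinal (mmi i)] = mm.
  by apply/mpoly.mnmP => i; rewrite mpoly.mnmE ffunE.
rewrite -[RHS](cP [ffun i => Ordinal (mmi i)]).
by apply: eq_bigr => k _; rewrite mpoly.mcoeffZ.
Qed.
End Counting.

(** * Germs of input-output maps *)

Section HasD.
Variables (R : realType) (m : nat) (U : {fset 'cV[R]_m}).
Local Notation time := (time R).
Local Notation io_fun := (io_fun U).
Local Notation pc_input := (pc_input U).
Implicit Types (phi psi : io_fun) (alpha : U) (u v : pc_input) (tau : time).

(** Existence and value of the limit in one relation; [D_], being a [lim], records a value even
    where there is no limit. *)
Definition has_D alpha phi u tau (d : R) : Prop :=
  right_derivative (ext (phi (splice u tau alpha))) tau%:num d.

Lemma has_D_E alpha phi u tau d : has_D alpha phi u tau d -> D_ alpha phi u tau = d.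
Proof.
move=> H; rewrite /D_; apply/cvg_lim => //.
by move: H; rewrite /has_D /right_derivative ext_num.
Qed.

Lemma splice_eq u v tau alpha :
  (forall s : time, s%:num < tau%:num -> u s = v s) ->
  splice u tau alpha = splice v tau alpha.
Proof.
move=> uv; have E : splice_fun u tau alpha = splice_fun v tau alpha.
  by apply/funext => s; rewrite /splice_fun; case: ltP => // /uv.
rewrite /splice; move: (@splice_pc _ _ _ v tau alpha); rewrite -E => p.
by congr PCInput; exact: Prop_irrelevance.
Qed.

(** True for any [phi], since the spliced input keeps of [u] only what precedes [tau]. *)
Lemma D_strictly_causal alpha phi : strictly_causal (D_ alpha phi).
Proof. by move=> u v tau uv; rewrite /D_ (splice_eq alpha uv). Qed.

Lemma has_D_cst alpha (c : R) u tau : has_D alpha (fun _ _ => c) u tau 0.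
Proof. exact: right_derivative_cst. Qed.

Lemma has_DD alpha phi psi u tau d d' :
  has_D alpha phi u tau d -> has_D alpha psi u tau d' ->
  has_D alpha (fun v s => phi v s + psi v s) u tau (d + d').
Proof. exact: right_derivativeD. Qed.

Lemma has_DM alpha phi psi u tau d d' : strictly_causal phi -> strictly_causal psi ->
  has_D alpha phi u tau d -> has_D alpha psi u tau d' ->
  has_D alpha (fun v s => phi v s * psi v s) u tau (d * psi u tau + phi u tau * d').
Proof.
move=> sphi spsi dphi dpsi; have := right_derivativeM dphi dpsi.
by rewrite !ext_num !splice_now.
Qed.

Lemma has_D_comp alpha phi (h : R -> R) u tau d d' : strictly_causal phi ->
  has_D alpha phi u tau d -> is_derive (phi u tau) 1 h d' ->
  has_D alpha (fun v s => h (phi v s)) u tau (d' * d).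
Proof.
move=> sphi dphi dh; apply: (right_derivative_comp dphi).
by rewrite ext_num splice_now.
Qed.
End HasD.

Section Germ.
Variables (R : realType) (m : nat) (U : {fset 'cV[R]_m}).
Local Notation time := (time R).
Local Notation io_fun := (io_fun U).
Local Notation pc_input := (pc_input U).
Implicit Types (phi psi : io_fun) (alpha : U) (u v : pc_input) (tau : time).
Variables (a0 : nat -> U) (t0 : nat -> time) (l0 : nat).
Hypothesis t00 : forall i, (l0 <= i)%N -> (t0 i)%:num = 0.

(* The base word [a0 t0 l0] may be followed by any letters of small duration:
   this is what makes germs stable under [D_ alpha]. *)
Definition germ (E : pc_input -> time -> Prop) : Prop :=
  forall a l, (forall i, (i < l0)%N -> a i = a0 i) -> (l0 <= l)%N ->
    \forall t \near word_nbhs t0 l, E (word_input a t l) (elapsed t l).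

Lemma germ_mono (E E' : pc_input -> time -> Prop) :
  (forall u tau, E u tau -> E' u tau) -> germ E -> germ E'.
Proof. by move=> EE gE a l aa ll; apply: filterS (gE a l aa ll) => t; exact: EE. Qed.

Lemma germ_all (E : pc_input -> time -> Prop) : (forall u tau, E u tau) -> germ E.
Proof. by move=> HE a l _ _; apply: filterE => t; exact: HE. Qed.

Lemma germ_and (E E' : pc_input -> time -> Prop) : germ E -> germ E' ->
  germ (fun u tau => E u tau /\ E' u tau).
Proof. by move=> gE gE' a l aa ll; apply: filterI; [exact: gE|exact: gE']. Qed.

Lemma germ_forall (I : finType) (E : I -> pc_input -> time -> Prop) :
  (forall i, germ (E i)) -> germ (fun u tau => forall i, E i u tau).
Proof.
move=> gE a l aa ll; apply: filter_forall => i; exact: gE.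
Qed.

(** As [t0] is zero past [l0], appending [alpha] for a short time gives a longer word still near the
    base word. Equality of germs therefore persists just after [tau] on the spliced input. *)
Lemma germ_right phi psi alpha : strictly_causal phi -> strictly_causal psi ->
  germ (fun u tau => phi u tau = psi u tau) ->
  germ (fun u tau => \forall s \near 0^'+,
    ext (phi (splice u tau alpha)) (tau%:num + s) =
    ext (psi (splice u tau alpha)) (tau%:num + s)).
Proof.
move=> sphi spsi gE a l aa ll.
have [|e /= e0 eP] := gE (upd a l alpha) l.+1 _ (leqW ll).
  by move=> i il; rewrite upd_lt ?aa// (leq_trans il).
exists e => // t tt0; apply/near_right0P; exists e => // s /andP[s0 se].
have sE : s = (NngNum (ltW s0))%:num by [].
rewrite sE !splice_value//; apply: eP => i; rewrite ltnS leq_eqVlt => /predU1P[->|il].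
  by rewrite upd_eq t00// subr0 ger0_norm.
by rewrite upd_lt//; exact: tt0.
Qed.

Lemma germ_has_D phi psi alpha (d : io_fun) : strictly_causal phi -> strictly_causal psi ->
  germ (fun u tau => phi u tau = psi u tau) ->
  germ (fun u tau => has_D alpha phi u tau (d u tau)) ->
  germ (fun u tau => has_D alpha psi u tau (d u tau)).
Proof.
move=> sphi spsi gE gD.
apply: germ_mono (germ_and gE (germ_and gD (germ_right alpha sphi spsi gE))).
move=> u tau [E [D N]]; apply: right_derivative_near D => //.
by rewrite !ext_num !splice_now.
Qed.

(** Put the base letters in front of any word. With zero durations on these letters one recovers the
    given word, with zero durations on the others the base word. Along the segment joining the two
    choices [f] is analytic, and it vanishes near the base end. *)
Lemma germ_zero (f : io_fun) : causal_analytic f -> strictly_causal f ->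
  germ (fun u tau => f u tau = 0) -> forall u tau, f u tau = 0.
Proof.
move=> [_ _ fan] sf gf u tau.
have [b [s [l [fu ->]]]] := piecewise_constant_follows u tau.
pose L := (l0 + l)%N.
pose a i := if (i < l0)%N then a0 i else b (i - l0)%N.
(* Index [L] receives zero duration: [analytic_io] takes words with at least one letter, so the word
   has length [L.+1]. *)
pose t1 i := if (i < l0)%N then NngNum (lexx (0 : R)) else
             if (i < L)%N then s (i - l0)%N else NngNum (lexx (0 : R)).
have el0 i : (i <= l0)%N -> (elapsed t1 i)%:num = 0.
  elim: i => [|i IH] il; first exact: elapsed0.
  by rewrite elapsedS IH ?(ltnW il)// add0r /t1 il.
have el1 j : (j <= l)%N -> (elapsed t1 (l0 + j))%:num = (elapsed s j)%:num.
  elim: j => [|j IH] jl; first by rewrite addn0 el0// elapsed0.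
  rewrite addnS !elapsedS IH ?(ltnW jl)//; congr (_ + _).
  by rewrite /t1 ltnNge leq_addr /= ltn_add2l jl addKn.
have t1L : (t1 L)%:num = 0 by rewrite /t1 ltnNge leq_addr /= ltnn.
have elL : elapsed t1 L.+1 = elapsed s l.
  by apply/val_inj; rewrite [LHS]elapsedS t1L addr0 el1.
have fu1 : follows u a t1 L.+1.
  move=> i rho; rewrite ltnS leq_eqVlt => /predU1P[->|iL].
    by rewrite elapsedS t1L addr0 => /andP[h1 h2]; have := le_lt_trans h1 h2; rewrite ltxx.
  have [il|li] := ltnP i l0.
    by rewrite !el0// 1?ltnW// => /andP[h1 h2]; have := le_lt_trans h1 h2; rewrite ltxx.
  have jl : (i - l0 < l)%N by rewrite ltn_subLR.
  rewrite -(subnKC li) -addnS !el1// 1?ltnW// => H.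
  by rewrite /a ltnNge leq_addr /= addKn; exact: fu.
rewrite -elL (follows_value sf fu1).
pose F (t : 'I_L.+1 -> time) := f (switched (fun i : 'I_L.+1 => a i) t) (switch_time t L.+1).
have FE (t : nat -> time) : F (fun i => t i) = word_value f a t L.+1.
  rewrite /F switch_timeE//; apply: follows_value => // i rho.
  rewrite ltnS leq_eqVlt => /predU1P[->|iL] /andP[h1 h2].
    exact: word_input_last.
  by apply: (@word_input_follows _ _ _ a t L i rho iL); rewrite h1.
pose lift_time (t : 'I_L.+1 -> time) i := t (inord i).
have FE' t : F t = word_value f a (lift_time t) L.+1.
  by rewrite -FE; congr F; apply/funext => i; rewrite /lift_time inord_val.
have [|e /= e0 eP] := gf a L.+1 _ (leqW (leq_addr _ _)).
  by move=> i il; rewrite /a il.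
pose p0 (i : 'I_L.+1) := t0 i; pose p1 (i : 'I_L.+1) := t1 i.
have := analytic_on_identity ltr01 (orthant_analytic_segment p0 p1 (fan L (fun i : 'I_L.+1 => a i))).
have near0 : exists2 r, 0 < r & forall x, 0 <= x < 0 + r -> x <= 1 -> F (segment p0 p1 x) = 0.
  pose M := \sum_i `|(p1 i)%:num - (p0 i)%:num| + 1.
  have M0 : 0 < M by rewrite ltr_wpDl// sumr_ge0.
  exists (e / M); first by rewrite divr_gt0.
  move=> x /andP[x0]; rewrite add0r => xe x1; rewrite FE'; apply: eP => i iL.
  have -> : t0 i = p0 (inord i) by rewrite /p0 inordK.
  rewrite /lift_time segmentE ?x0// addrAC subrr add0r normrM ger0_norm//.
  apply: le_lt_trans (_ : x * M < _); last by rewrite -ltr_pdivlMr.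
  by rewrite ler_wpM2l// /M (bigD1 (inord i))//= -addrA lerDl addr_ge0// sumr_ge0.
move=> /(_ near0 1); rewrite ler01 lexx => /(_ isT).
by rewrite -[LHS]/(F (segment p0 p1 1)) segment1 /p1 FE.
Qed.
End Germ.

(** * Germs rational in finitely many generators, and the transcendence bound *)

Section LocalRing.
Variables (R : realType) (m : nat) (U : {fset 'cV[R]_m}).
Local Notation time := (time R).
Local Notation io_fun := (io_fun U).
Local Notation pc_input := (pc_input U).
Implicit Types (phi psi : io_fun) (alpha : U) (u v : pc_input) (tau : time).
Variables (a0 : nat -> U) (t0 : nat -> time) (l0 : nat).
Hypothesis t00 : forall i, (l0 <= i)%N -> (t0 i)%:num = 0.
Local Notation germ := (germ a0 t0 l0).
Variables (D : nat) (g : 'I_D -> io_fun).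
Hypothesis g_causal : forall i, strictly_causal (g i).

Definition poly_io (P : mpoly.mpoly D R) : io_fun :=
  fun u tau => mpoly.meval (fun i => g i u tau) P.

Lemma poly_io_causal P : strictly_causal (poly_io P).
Proof. by move=> u v tau uv; apply: mpoly.meval_eq => i; exact: g_causal. Qed.

(** The denominator is nonzero at every word near the base one, not just a nonzero germ, so that
    fractions make sense without an integral domain of germs. *)
Definition germ_rational phi : Prop := strictly_causal phi /\
  exists P B, germ (fun u tau => poly_io B u tau != 0 /\
                                 phi u tau * poly_io B u tau = poly_io P u tau).

Lemma germ_rational_poly P : germ_rational (poly_io P).
Proof.
split; first exact: poly_io_causal.
exists P, 1; apply: germ_all => u tau.
by rewrite /poly_io mpoly.meval1 mulr1 oner_eq0.
Qed.

Lemma germ_rational_cst (c : R) : germ_rational (fun _ _ => c).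
Proof.
have := germ_rational_poly (mpoly.mpolyC D c).
have -> // : poly_io (mpoly.mpolyC D c) = fun _ _ => c.
by apply/funext => u; apply/funext => tau; rewrite /poly_io mpoly.mevalC.
Qed.

Lemma germ_rational_gen i : germ_rational (g i).
Proof.
have := germ_rational_poly (mpoly.mpolyX R (mpoly.mnm1 i)).
have -> // : poly_io (mpoly.mpolyX R (mpoly.mnm1 i)) = g i.
by apply/funext => u; apply/funext => tau; rewrite /poly_io mpoly.mevalXU.
Qed.

Lemma germ_rationalD phi psi : germ_rational phi -> germ_rational psi ->
  germ_rational (fun u tau => phi u tau + psi u tau).
Proof.
move=> [sphi [P [B gP]]] [spsi [P' [B' gP']]]; split.
  by move=> u v tau uv; rewrite (sphi u v)// (spsi u v).
exists (P * B' + P' * B), (B * B').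
apply: germ_mono (germ_and gP gP') => u tau [[B0 E] [B'0 E']].
rewrite /poly_io mpoly.mevalD !mpoly.mevalM -!/(poly_io _ u tau) -E -E'.
by split; [rewrite mulf_neq0|ring].
Qed.

Lemma germ_rationalM phi psi : germ_rational phi -> germ_rational psi ->
  germ_rational (fun u tau => phi u tau * psi u tau).
Proof.
move=> [sphi [P [B gP]]] [spsi [P' [B' gP']]]; split.
  by move=> u v tau uv; rewrite (sphi u v)// (spsi u v).
exists (P * P'), (B * B').
apply: germ_mono (germ_and gP gP') => u tau [[B0 E] [B'0 E']].
rewrite /poly_io !mpoly.mevalM -!/(poly_io _ u tau) -E -E'.
by split; [rewrite mulf_neq0|ring].
Qed.

Lemma germ_rationalV phi : germ_rational phi -> germ (fun u tau => phi u tau != 0) ->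
  germ_rational (fun u tau => (phi u tau)^-1).
Proof.
move=> [sphi [P [B gP]]] g0; split.
  by move=> u v tau uv; rewrite (sphi u v).
exists B, P; apply: germ_mono (germ_and gP g0) => u tau [[B0 E] p0].
by split; rewrite -E ?mulf_neq0// mulrA mulVf// mul1r.
Qed.

Lemma germ_rational_eq phi psi : strictly_causal psi ->
  germ (fun u tau => phi u tau = psi u tau) -> germ_rational phi -> germ_rational psi.
Proof.
move=> spsi gE [_ [P [B gP]]]; split => //; exists P, B.
by apply: germ_mono (germ_and gE gP) => u tau [->].
Qed.

Definition germ_derivable phi : Prop := germ_rational phi /\
  forall alpha, exists2 d, germ_rational d &
    germ (fun u tau => has_D alpha phi u tau (d u tau)).

Lemma germ_derivable_cst (c : R) : germ_derivable (fun _ _ => c).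
Proof.
split; first exact: germ_rational_cst.
move=> alpha; exists (fun _ _ => 0); first exact: germ_rational_cst.
by apply: germ_all => u tau; exact: has_D_cst.
Qed.

Lemma germ_derivableD phi psi : germ_derivable phi -> germ_derivable psi ->
  germ_derivable (fun u tau => phi u tau + psi u tau).
Proof.
move=> [rphi dphi] [rpsi dpsi]; split; first exact: germ_rationalD.
move=> alpha; have [d rd gd] := dphi alpha; have [d' rd' gd'] := dpsi alpha.
exists (fun u tau => d u tau + d' u tau); first exact: germ_rationalD.
by apply: germ_mono (germ_and gd gd') => u tau [? ?]; exact: has_DD.
Qed.

Lemma germ_derivableM phi psi : germ_derivable phi -> germ_derivable psi ->
  germ_derivable (fun u tau => phi u tau * psi u tau).
Proof.
move=> [rphi dphi] [rpsi dpsi]; split; first exact: germ_rationalM.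
move=> alpha; have [d rd gd] := dphi alpha; have [d' rd' gd'] := dpsi alpha.
exists (fun u tau => d u tau * psi u tau + phi u tau * d' u tau).
  by apply: germ_rationalD; exact: germ_rationalM.
apply: germ_mono (germ_and gd gd') => u tau [? ?]; apply: has_DM => //.
  exact: rphi.1.
exact: rpsi.1.
Qed.

Lemma germ_derivableV phi : germ_derivable phi -> germ (fun u tau => phi u tau != 0) ->
  germ_derivable (fun u tau => (phi u tau)^-1).
Proof.
move=> [rphi dphi] g0; have rV := germ_rationalV rphi g0; split => // alpha.
have [d rd gd] := dphi alpha.
exists (fun u tau => - 1 * ((phi u tau)^-1 * (phi u tau)^-1) * d u tau).
  apply: germ_rationalM => //; apply: (germ_rationalM (germ_rational_cst _)).
  exact: germ_rationalM.
apply: germ_mono (germ_and g0 gd) => u tau [p0 pd].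
apply: (@has_D_comp _ _ _ alpha phi (fun y => y^-1) u tau) => //; first exact: rphi.1.
apply: is_derive_eq; first exact: is_deriveV.
by rewrite /GRing.scale /= mulr1 mulN1r -expr2 exprVn.
Qed.

Lemma germ_derivable_eq phi psi : strictly_causal psi ->
  germ (fun u tau => phi u tau = psi u tau) -> germ_derivable phi -> germ_derivable psi.
Proof.
move=> spsi gE [rphi dphi]; split; first exact: germ_rational_eq gE rphi.
move=> alpha; have [d rd gd] := dphi alpha; exists d => //.
by apply: germ_has_D gd => //; exact: rphi.1.
Qed.

Hypothesis g_derivable : forall i alpha, exists2 d, germ_rational d &
  germ (fun u tau => has_D alpha (g i) u tau (d u tau)).

Lemma germ_derivable_poly P : germ_derivable (poly_io P).
Proof.
pose Cl (f : pc_input * time -> R) := germ_derivable (fun u tau => f (u, tau)).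
have := @meval_closed R _ D Cl (fun i x => g i x.1 x.2); apply.
- exact: germ_derivable_cst.
- by move=> f h; exact: germ_derivableD.
- by move=> f h; exact: germ_derivableM.
- by move=> i; split; [exact: germ_rational_gen|exact: g_derivable].
Qed.

Lemma germ_rational_derivable phi : germ_rational phi -> germ_derivable phi.
Proof.
move=> [sphi [P [B gP]]].
apply: (@germ_derivable_eq (fun u tau => poly_io P u tau * (poly_io B u tau)^-1)) => //.
  by apply: germ_mono gP => u tau [B0 <-]; rewrite mulfK.
apply: germ_derivableM; first exact: germ_derivable_poly.
apply: germ_derivableV; first exact: germ_derivable_poly.
by apply: germ_mono gP => u tau [].
Qed.

Lemma germ_rational_D_ alpha phi : germ_rational phi -> germ_rational (D_ alpha phi).
Proof.
move=> rphi; have [_ /(_ alpha)[d rd gd]] := germ_rational_derivable rphi.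
apply: germ_rational_eq rd; first exact: D_strictly_causal.
by apply: germ_mono gd => u tau /has_D_E.
Qed.

(** Rational germs form one of the sets [S] intersected in the definition of the observation
    algebra. *)
Lemma obs_algebra_rational (q : nat) (out : pc_input -> time -> 'cV[R]_q) :
  (forall i, germ_rational (fun u t => out u t i 0)) ->
  obs_algebra out `<=` germ_rational.
Proof.
move=> outQ phi [_]; apply => //.
  split=> [c|phi1 psi1|phi1 psi1]; first exact: germ_rational_cst.
    exact: germ_rationalD.
  exact: germ_rationalM.
by move=> alpha psi _; exact: germ_rational_D_.
Qed.

(** If [d] exceeded [D], the formal relation between the polynomials representing the [z i] would
    give an element [f] of the algebra that vanishes near the base word, hence everywhere. Its image
    under [iota] is then a nontrivial relation between the [z i]. *)
Lemma trdeg_obs_algebra_le (q : nat) (out : pc_input -> time -> 'cV[R]_q) (d : nat) :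
  (forall i, germ_rational (fun u t => out u t i 0)) ->
  trdeg (obs_algebra out) d -> (d <= D)%N.
Proof.
move=> outQ [L [iota [[[Scst SD SM] iota1 iotaDM iota_inj frac] [[z zind] _]]]].
rewrite leqNgt; apply/negP => Dd.
set S := obs_algebra out in Scst SD SM iotaDM iota_inj frac.
have SQ : S `<=` germ_rational := obs_algebra_rational outQ.
have [nd ndP] : exists nd : 'I_d -> io_fun * io_fun, forall i,
    [/\ S (nd i).1, S (nd i).2, (nd i).2 != 0 & z i = iota (nd i).1 / iota (nd i).2].
  have /choice[nd ndP] : forall i, exists nd : io_fun * io_fun,
      [/\ S nd.1, S nd.2, nd.2 != 0 & z i = iota nd.1 / iota nd.2].
    by move=> i; have [phi [psi [? ? ? ?]]] := frac (z i); exists (phi, psi).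
  by exists nd.
(* A common denominator [(PB i).2] for the two elements whose quotient is [z i]: it cancels, leaving
   [(PB i).1.1 / (PB i).1.2]. *)
have [PB PBP] : exists PB : 'I_d -> (mpoly.mpoly D R * mpoly.mpoly D R * mpoly.mpoly D R),
    forall i, germ (fun u tau => [/\ poly_io (PB i).2 u tau != 0,
      (nd i).1 u tau * poly_io (PB i).2 u tau = poly_io (PB i).1.1 u tau &
      (nd i).2 u tau * poly_io (PB i).2 u tau = poly_io (PB i).1.2 u tau]).
  suff /choice[PB PBP] : forall i, exists PB : mpoly.mpoly D R * mpoly.mpoly D R * mpoly.mpoly D R,
      germ (fun u tau => [/\ poly_io PB.2 u tau != 0,
      (nd i).1 u tau * poly_io PB.2 u tau = poly_io PB.1.1 u tau &
      (nd i).2 u tau * poly_io PB.2 u tau = poly_io PB.1.2 u tau]).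
    by exists PB.
  move=> i.
  have [S1 S2 _ _] := ndP i.
  have [_ [P [B gP]]] := SQ _ S1; have [_ [P' [B' gP']]] := SQ _ S2.
  exists (P * B', P' * B, B * B') => /=.
  apply: germ_mono (germ_and gP gP') => u tau [[B0 E] [B'0 E']].
  rewrite /poly_io !mpoly.mevalM -!/(poly_io _ u tau) -E -E'.
  by split; [rewrite mulf_neq0|ring|ring].
have [M [c [k0 ck0] rel]] := rational_functions_dependent
  (fun i => (PB i).1.1) (fun i => (PB i).1.2) Dd.
(* The relation with denominators cleared stays in the observation algebra, so [f] is causal and
   analytic although the generators need not be. *)
pose f : io_fun := \sum_(k : {ffun 'I_d -> 'I_M.+1})
  cst (cst (c k)) * \prod_i ((nd i).1 ^+ k i * (nd i).2 ^+ (M - k i)).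
have iota0 : iota 0 = 0.
  have [+ _] := iotaDM _ _ (Scst 0) (Scst 0).
  rewrite (_ : cst (cst 0) = 0)// addr0 => /eqP.
  by rewrite -{1}[iota 0]addr0 (inj_eq (addrI _)) eq_sym => /eqP.
have SX phi n : S phi -> S (phi ^+ n) /\ iota (phi ^+ n) = iota phi ^+ n.
  move=> Sphi; elim: n => [|n [Sn En]].
    by rewrite !expr0; split => //; exact: (Scst 1).
  by rewrite !exprS; have [_ ->] := iotaDM _ _ Sphi Sn; rewrite En; split => //; exact: SM.
have Sprod (I : Type) (r : seq I) (F : I -> io_fun) : (forall i, S (F i)) ->
    S (\prod_(i <- r) F i) /\ iota (\prod_(i <- r) F i) = \prod_(i <- r) iota (F i).
  move=> SF; elim: r => [|i r [Sr Er]].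
    by rewrite !big_nil; split => //; exact: (Scst 1).
  by rewrite !big_cons; have [_ ->] := iotaDM _ _ (SF i) Sr; rewrite Er; split => //; exact: SM.
have Ssum (I : Type) (r : seq I) (F : I -> io_fun) : (forall i, S (F i)) ->
    S (\sum_(i <- r) F i) /\ iota (\sum_(i <- r) F i) = \sum_(i <- r) iota (F i).
  move=> SF; elim: r => [|i r [Sr Er]].
    by rewrite !big_nil; split => //; exact: (Scst 0).
  by rewrite !big_cons; have [-> _] := iotaDM _ _ (SF i) Sr; rewrite Er; split => //; exact: SD.
have Sfac (k : {ffun 'I_d -> 'I_M.+1}) i :
    S ((nd i).1 ^+ k i * (nd i).2 ^+ (M - k i)) /\
    iota ((nd i).1 ^+ k i * (nd i).2 ^+ (M - k i)) =
    iota (nd i).2 ^+ M * z i ^+ k i.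
  have [S1 S2 n0 zE] := ndP i; have [S1k E1] := SX _ (k i) S1; have [S2k E2] := SX _ (M - k i)%N S2.
  split; first exact: SM.
  have [_ ->] := iotaDM _ _ S1k S2k; rewrite E1 E2 zE.
  have i0 : iota (nd i).2 != 0.
    by apply: contra_neq n0 => E; apply: iota_inj => //; [exact: (Scst 0)|rewrite iota0].
  have kM : (k i <= M)%N by rewrite -ltnS.
  have -> : iota (nd i).2 ^+ M = iota (nd i).2 ^+ (M - k i) * iota (nd i).2 ^+ k i.
    by rewrite -exprD subnK.
  by rewrite -mulrA -exprMn mulrCA mulfV// mulr1 mulrC.
have Sterm (k : {ffun 'I_d -> 'I_M.+1}) :
    S (cst (cst (c k)) * \prod_i ((nd i).1 ^+ k i * (nd i).2 ^+ (M - k i))) /\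
    iota (cst (cst (c k)) * \prod_i ((nd i).1 ^+ k i * (nd i).2 ^+ (M - k i))) =
    iota (cst (cst (c k))) * \prod_i z i ^+ k i * \prod_i iota (nd i).2 ^+ M.
  have [Sp Ep] := Sprod _ (index_enum _) _ (fun i => (Sfac k i).1).
  split; first exact: SM.
  have [_ ->] := iotaDM _ _ (Scst (c k)) Sp; rewrite Ep -mulrA; congr (_ * _).
  rewrite -big_split /=; apply: eq_bigr => i _; rewrite (Sfac k i).2; exact: mulrC.
have [Sf Ef] := Ssum _ (index_enum _) _ (fun k => (Sterm k).1).
rewrite -/f in Sf Ef.
have f0 : f = 0.
  apply/funext => u; apply/funext => tau.
  apply: (@germ_zero _ _ _ a0 t0 l0 f); [exact: Sf.1|exact: (SQ _ Sf).1|].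
  apply: germ_mono (germ_forall PBP) => {}u {}tau PBu.
  have sumE (I : Type) (r : seq I) (F : I -> io_fun) :
      (\sum_(i <- r) F i) u tau = \sum_(i <- r) F i u tau.
    by elim: r => [|i r IH]; rewrite ?big_nil// !big_cons -IH.
  have prodE (I : Type) (r : seq I) (F : I -> io_fun) :
      (\prod_(i <- r) F i) u tau = \prod_(i <- r) F i u tau.
    by elim: r => [|i r IH]; rewrite ?big_nil// !big_cons -IH.
  have expE (phi : io_fun) n : (phi ^+ n) u tau = phi u tau ^+ n.
    by elim: n => // n IH; rewrite !exprS -IH.
  pose w i := poly_io (PB i).2 u tau.
  (* All products have the same degree [M] in each pair, so this one factor separates [f] from the
     evaluated formal relation. *)
  have w0 : \prod_i w i ^+ M != 0.
    by apply/prodf_neq0 => i _; rewrite expf_neq0//; have [] := PBu i.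
  apply: (mulIf w0); rewrite mul0r.
  have := congr1 (mpoly.meval (fun i => g i u tau)) rel.
  rewrite mpoly.meval0 raddf_sum /= => <-; rewrite /f sumE mulr_suml.
  apply: eq_bigr => k _; rewrite mpoly.mevalZ rmorph_prod /= -mulrA; congr (_ * _).
  rewrite prodE -big_split /=; apply: eq_bigr => i _.
  have [_ E1 E2] := PBu i; have kM : (k i <= M)%N by rewrite -ltnS.
  rewrite rmorphM !rmorphXn /= -!/(poly_io _ u tau) -E1 -E2 -/(w i).
  have -> : w i ^+ M = w i ^+ k i * w i ^+ (M - k i) by rewrite -exprD subnKC.
  rewrite !exprMn -!expE mulrACA; congr (_ * _).
have n0 i : iota (nd i).2 != 0.
  have [_ S2 n0 _] := ndP i.
  by apply: contra_neq n0 => E; apply: iota_inj => //; [exact: (Scst 0)|rewrite iota0].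
(* Restricted to scalars, [iota] is a ring morphism; packing it gives access to the theory of
   [mpoly.mmap]. *)
pose fc (a : R) := iota (cst (cst a)).
have fcB : {morph fc : a b / a - b}.
  move=> a b; rewrite /fc -[X in iota (cst (cst X)) - _](subrK b).
  rewrite (_ : cst (cst (a - b + b)) = cst (cst (a - b)) + cst (cst b))//.
  by have [-> _] := iotaDM _ _ (Scst (a - b)) (Scst b); rewrite addrK.
have fcM : GRing.monoid_morphism fc.
  split=> [|a b]; first by rewrite /fc -iota1.
  by have [_ <-] := iotaDM _ _ (Scst a) (Scst b).
pose fc_add := GRing.isZmodMorphism.Build R L fc fcB.
pose fc_mul := GRing.isMonoidMorphism.Build R L fc fcM.
pose fcR : {rmorphism R -> L} := HB.pack fc fc_add fc_mul.
pose mon (k : {ffun 'I_d -> 'I_M.+1}) : mpoly.multinom d :=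
  mpoly.Multinom [tuple val (k i) | i < d].
have mon_inj : injective mon.
  move=> k k' /mpoly.mnmP E; apply/ffunP => i; apply/val_inj.
  by have := E i; rewrite !mpoly.mnmE.
pose P : mpoly.mpoly d R := \sum_k c k *: mpoly.mpolyX R (mon k).
have P0 : P = 0.
  apply: zind; rewrite -[LHS]/(mpoly.mmap fcR z P) raddf_sum /=.
  have iota_f : iota f = 0 by rewrite f0.
  have nM0 : \prod_i iota (nd i).2 ^+ M != 0.
    by apply/prodf_neq0 => i _; exact: expf_neq0.
  apply: (mulIf nM0); rewrite mul0r -[RHS]iota_f Ef.
  rewrite mulr_suml.
  apply: eq_bigr => k _; rewrite (Sterm k).2; congr (_ * _).
  rewrite [LHS](@mpoly.mmapZ d R L z fcR) (@mpoly.mmapX d R L z fcR); congr (_ * _).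
  by apply: eq_bigr => i _; rewrite mpoly.mnmE.
have := congr1 (mpoly.mcoeff (mon k0)) P0; rewrite mpoly.mcoeff0 /P raddf_sum /=.
rewrite (bigD1 k0)//= mpoly.mcoeffZ mpoly.mcoeffX eqxx mulr1 big1 ?addr0.
  by move/eqP; rewrite (negbTE ck0).
move=> k kk0; rewrite mpoly.mcoeffZ mpoly.mcoeffX (inj_eq mon_inj) (negbTE kk0).
by rewrite mulr0.
Qed.
End LocalRing.

(** * Recurrent neural networks *)

Section NetworkAlgebra.
Variables (R : realType) (m q N : nat) (U : {fset 'cV[R]_m}) (sigma : R -> R).
Local Notation time := (time R).
Local Notation io_fun := (io_fun U).
Local Notation pc_input := (pc_input U).
Variables (xi : 'I_N -> R -> R) (Num Den : 'I_N.+1 -> mpoly.mpoly N R).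
Hypothesis xi_analytic : forall j, real_analytic (xi j).
Hypothesis Den_neq0 : forall k, exists z, mpoly.meval (xi^~ z) (Den k) != 0.
Hypothesis sigma_eq : forall z, sigma z * mpoly.meval (xi^~ z) (Den ord0)
                                = mpoly.meval (xi^~ z) (Num ord0).
Hypothesis xi_eq : forall j z, derive1 (xi j) z * mpoly.meval (xi^~ z) (Den (lift ord0 j))
                               = mpoly.meval (xi^~ z) (Num (lift ord0 j)).
Variables (Sg : rnn m sigma q) (p : pc_input -> time -> 'cV[R]_q).
Local Notation n := (rnn_dim Sg).
Variable x : pc_input -> time -> 'cV[R]_n.
Hypothesis xP : forall u : pc_input, solution (x u) u (p u).
Implicit Types (alpha beta : U) (i h : 'I_n) (j : 'I_N).

Local Notation y := (pre_activation x).

Definition state_io h : io_fun := fun u tau => x u tau h 0.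
Definition xi_io j i alpha : io_fun := fun u tau => xi j (y alpha i u tau).
Definition meval_io (P : mpoly.mpoly N R) i alpha : io_fun :=
  fun u tau => mpoly.meval (fun j => xi_io j i alpha u tau) P.

Lemma state_io_causal h : strictly_causal (state_io h).
Proof. by move=> u v tau uv; rewrite /state_io (state_strictly_causal xP uv). Qed.

Lemma pre_activation_causal alpha i : strictly_causal (y alpha i).
Proof. by move=> u v tau uv; rewrite /pre_activation (state_strictly_causal xP uv). Qed.

Lemma xi_io_causal j i alpha : strictly_causal (xi_io j i alpha).
Proof. by move=> u v tau uv; rewrite /xi_io (pre_activation_causal alpha i uv). Qed.

Lemma state_has_D beta h u tau : has_D beta (state_io h) u tau (sigma (y beta h u tau)).
Proof.
have := @state_right_derivative _ _ _ _ _ _ _ _ xP (splice u tau beta) tau h.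
rewrite /= {1}/splice_fun ltxx splice_now//; exact: pre_activation_causal.
Qed.

Lemma pre_activation_has_D beta alpha i u tau :
  has_D beta (y alpha i) u tau (\sum_h matA Sg i h * sigma (y beta h u tau)).
Proof.
rewrite /has_D.
have -> : ext (y alpha i (splice u tau beta)) = (fun t => \sum_h matA Sg i h *
    ext (state_io h (splice u tau beta)) t + (matB Sg *m val alpha) i 0).
  by apply/funext => t; rewrite /ext pre_activationE.
rewrite -[\sum_h _]addr0; apply: right_derivativeD; last exact: right_derivative_cst.
apply: right_derivative_sum => h; apply: right_derivativeZ; exact: state_has_D.
Qed.

Lemma xi_has_D beta j alpha i u tau :
  has_D beta (xi_io j i alpha) u tau
    (derive1 (xi j) (y alpha i u tau) * \sum_h matA Sg i h * sigma (y beta h u tau)).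
Proof.
apply: has_D_comp; [exact: pre_activation_causal|exact: pre_activation_has_D|].
by rewrite derive1E; apply/derivableP; exact: real_analytic_derivable.
Qed.

Lemma meval_xi_continuous (P : mpoly.mpoly N R) :
  continuous (fun z => mpoly.meval (xi^~ z) P).
Proof.
move=> z; apply/differentiable_continuous/derivable1_diffP.
by apply: real_analytic_derivable; exact: real_analytic_meval.
Qed.

(* The word maximizes the number of denominators that do not vanish: extending
   it by small durations, a denominator that vanishes there keeps vanishing,
   which makes its argument constant, zeros of analytic functions being
   isolated. *)
Lemma exists_generic_word : U -> exists (a0 : nat -> U) (t0 : nat -> time) (l0 : nat),
  (forall e, (l0 <= e)%N -> (t0 e)%:num = 0) /\
  forall i alpha,
    (exists c, germ a0 t0 l0 (fun u tau => y alpha i u tau = c)) \/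
    (forall k, germ a0 t0 l0 (fun u tau => meval_io (Den k) i alpha u tau != 0)).
Proof.
move=> alpha0.
pose J : finType := ('I_N.+1 * 'I_n * U)%type.
pose w (k : J) := meval_io (Den k.1.1) k.1.2 k.2.
(* The denominators that are nonzero at the end of a word; [c] is the largest size of such a set. *)
pose Z a t l : {set J} := finset (fun k : J => word_value (w k) a t l != 0).
pose P c := `[< exists a t l, #|Z a t l| = c >].
have exP : exists c, P c.
  exists #|Z (fun=> alpha0) (fun=> NngNum (lexx (0 : R))) 0%N|; apply/asboolP.
  by exists (fun=> alpha0), (fun=> NngNum (lexx (0 : R))), 0%N.
have boundP c : P c -> (c <= #|J|)%N.
  by move=> /asboolP[a [t [l <-]]]; exact: max_card.
case: (ex_maxnP exP boundP) => c /asboolP[a0 [t' [l0 Zc]]] cmax.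
(* Durations past [l0] are reset to zero: words continuing the base one then end at the same time
   with the same values. *)
pose t0 (e : nat) := if (e < l0)%N then t' e else NngNum (lexx (0 : R)).
have t00 e : (l0 <= e)%N -> (t0 e)%:num = 0 by rewrite /t0 ltnNge => ->.
exists a0, t0, l0; split => //.
have sub_word (X : Type) (phi : pc_input -> time -> X) a l : strictly_causal phi ->
    (forall e, (e < l0)%N -> a e = a0 e) -> (l0 <= l)%N ->
    word_value phi a t0 l = word_value phi a0 t' l0.
  move=> sphi aa ll.
  have E : elapsed t0 l = elapsed t' l0.
    rewrite -(@eq_elapsed _ t0 t'); last by move=> e el; rewrite /t0 el.
    apply/val_inj; rewrite /= -(subnKC ll) big_split_ord /=.
    by rewrite [X in _ + X]big1 ?addr0// => e _; rewrite t00// leq_addr.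
  rewrite /word_value E; apply: follows_value => //.
  have : follows (word_input a t0 l) a t0 l0.
    by move=> e tau el; apply: (@word_input_follows _ _ _ a t0 l e tau); exact: leq_trans ll.
  by apply: follows_eq => // e el; rewrite /t0 el.
have y_cvg alpha i a l : (forall e, (e < l0)%N -> a e = a0 e) -> (l0 <= l)%N ->
    word_value (y alpha i) a t l @[t --> word_nbhs t0 l] --> word_value (y alpha i) a0 t' l0.
  move=> aa ll; rewrite -(sub_word _ _ a l (pre_activation_causal alpha i) aa ll).
  under eq_fun do rewrite /word_value pre_activationE.
  rewrite /word_value pre_activationE; apply: cvgD; last exact: cvg_cst.
  apply: cvg_big => [|h _]; first exact: add_continuous.
  by apply: cvgM; [exact: cvg_cst|exact: state_word_continuous].
have germ_nonzero (k : J) : k \in Z a0 t' l0 ->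
    germ a0 t0 l0 (fun u tau => w k u tau != 0).
  rewrite inE => k0 a l aa ll.
  have := cvg_comp _ _ (y_cvg k.2 k.1.2 a l aa ll) (@meval_xi_continuous (Den k.1.1) _).
  move=> H; apply: (cvgr_neq0 _ H) => //.
move=> i alpha.
have [allk|] := pselect (forall k, (k, i, alpha) \in Z a0 t' l0).
  by right => k; exact: (germ_nonzero (k, i, alpha)).
move=> /existsNP[k /negP kZ]; left.
set c0 := word_value (y alpha i) a0 t' l0; exists c0 => a l aa ll.
(* Within [r] of [c0], only [c0] itself can be a zero of this denominator. *)
have [r r0 rP] := real_analytic_isolated_zero c0 (real_analytic_meval (Den k) xi_analytic) (Den_neq0 k).
have Znear : \forall t \near word_nbhs t0 l, forall k' : J, k' \in Z a0 t' l0 ->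
    word_value (w k') a t l != 0.
  apply: filter_forall => k'; have [k'Z|k'Z] := boolP (k' \in Z a0 t' l0); last exact: filterE.
  by apply: filterS (germ_nonzero k' k'Z a l aa ll) => t.
have /cvgrPdist_lt/(_ _ r0) ynear := y_cvg alpha i a l aa ll.
apply: filterS2 Znear ynear => t Zt yt.
(* Nonvanishing denominators stay so near the base word; were this one nonzero too, [Z a t l] would
   have more than [c] elements. *)
have wt : word_value (w (k, i, alpha)) a t l = 0.
  apply/eqP/negPn/negP => wt.
  have : (#|Z a t l| <= c)%N by apply: cmax; apply/asboolP; exists a, t, l.
  rewrite leqNgt -Zc => /negP; apply; apply: proper_card; apply/properP; split.
    by apply/fintype.subsetP => k' /Zt; rewrite inE.
  by exists (k, i, alpha); [rewrite inE|].
apply/eqP; apply: contraTT (eqxx (0 : R)) => yc.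
rewrite -[X in X == _]wt; apply: rP.
by rewrite normr_gt0 subr_eq0 yc distrC.
Qed.

(** * Families of generators, with or without the states *)

Section Generators.
Variables (a0 : nat -> U) (t0 : nat -> time) (l0 : nat).
Hypothesis t00 : forall e, (l0 <= e)%N -> (t0 e)%:num = 0.
Hypothesis generic : forall i alpha,
    (exists c, germ a0 t0 l0 (fun u tau => y alpha i u tau = c)) \/
    (forall k, germ a0 t0 l0 (fun u tau => meval_io (Den k) i alpha u tau != 0)).
Variables (D : nat) (g : 'I_D -> io_fun).
Hypothesis g_cases : forall d, (exists h, g d = state_io h) \/
  (exists j i alpha, g d = xi_io j i alpha).
Hypothesis g_xi : forall j i alpha, exists d, g d = xi_io j i alpha.
Local Notation rational := (germ_rational a0 t0 l0 g).

Lemma gen_causal d : strictly_causal (g d).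
Proof.
case: (g_cases d) => [[h ->]|[j [i [alpha ->]]]]; [exact: state_io_causal|exact: xi_io_causal].
Qed.

Lemma meval_io_rational P i alpha : rational (meval_io P i alpha).
Proof.
pose Cl (f : pc_input * time -> R) := rational (fun u tau => f (u, tau)).
have := @meval_closed R _ N Cl (fun j z => xi_io j i alpha z.1 z.2); apply.
- by move=> c; apply: germ_rational_cst; exact: gen_causal.
- by move=> f f'; exact: germ_rationalD.
- by move=> f f'; exact: germ_rationalM.
- by move=> j; have [d <-] := g_xi j i alpha; exact: (germ_rational_gen _ _ _ gen_causal).
Qed.

(** Where the argument is constant the denominator may vanish, but [sigma] is then a constant germ;
    elsewhere [sigma_eq] gives a quotient. *)
Lemma sigma_rational i alpha : rational (fun u tau => sigma (y alpha i u tau)).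
Proof.
have sc : strictly_causal (fun u tau => sigma (y alpha i u tau)).
  by move=> u v tau uv; rewrite (pre_activation_causal alpha i uv).
case: (generic i alpha) => [[c gc]|gk].
  apply: (germ_rational_eq (phi := fun _ _ => sigma c) sc).
    by apply: germ_mono gc => u tau ->.
  by apply: germ_rational_cst; exact: gen_causal.
apply: (germ_rational_eq (phi := fun u tau =>
  meval_io (Num ord0) i alpha u tau * (meval_io (Den ord0) i alpha u tau)^-1) sc).
  apply: germ_mono (gk ord0) => u tau D0.
  by rewrite /meval_io -sigma_eq mulfK.
apply: germ_rationalM; first exact: meval_io_rational.
by apply: germ_rationalV => //; exact: meval_io_rational.
Qed.

Lemma germ_rational_sum (I : Type) (r : seq I) (c : I -> R) (f : I -> io_fun) :
  (forall k, rational (f k)) -> rational (fun u tau => \sum_(k <- r) c k * f k u tau).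
Proof.
have rc c0 : rational (fun _ _ => c0) by apply: germ_rational_cst; exact: gen_causal.
move=> rf; elim: r => [|k r IH].
  have -> // : (fun u tau => \sum_(k <- [::]) c k * f k u tau) = fun _ _ => 0.
  by apply/funext => u; apply/funext => tau; rewrite big_nil.
have -> : (fun u tau => \sum_(k <- k :: r) c k * f k u tau) =
    (fun u tau => c k * f k u tau + \sum_(k <- r) c k * f k u tau).
  by apply/funext => u; apply/funext => tau; rewrite big_cons.
by apply: germ_rationalD => //; exact: germ_rationalM.
Qed.

(** No derivative involves the states: that of a state is some [sigma (y beta h)], that of [xi_io] a
    combination of these with a rational factor. Hence the [xi_io] alone already suffice for
    closure. *)
Lemma gen_derivable d beta : exists2 e, rational e &
  germ a0 t0 l0 (fun u tau => has_D beta (g d) u tau (e u tau)).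
Proof.
case: (g_cases d) => [[h ->]|[j [i [alpha ->]]]].
  exists (fun u tau => sigma (y beta h u tau)); first exact: sigma_rational.
  by apply: germ_all => u tau; exact: state_has_D.
case: (generic i alpha) => [[c gc]|gk].
  exists (fun _ _ => 0); first by apply: germ_rational_cst; exact: gen_causal.
  apply: (germ_has_D t00 (phi := fun _ _ => xi j c)) => //.
  - exact: xi_io_causal.
  - by apply: germ_mono gc => u tau; rewrite /xi_io => ->.
  - by apply: germ_all => u tau; exact: has_D_cst.
exists (fun u tau => meval_io (Num (lift ord0 j)) i alpha u tau *
    (meval_io (Den (lift ord0 j)) i alpha u tau)^-1 *
    \sum_h matA Sg i h * sigma (y beta h u tau)).
  apply: germ_rationalM; last by apply: germ_rational_sum => h; exact: sigma_rational.
  apply: germ_rationalM; first exact: meval_io_rational.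
  by apply: germ_rationalV => //; exact: meval_io_rational.
apply: germ_mono (gk (lift ord0 j)) => u tau D0.
have := @xi_has_D beta j alpha i u tau.
rewrite (_ : derive1 _ _ = meval_io (Num (lift ord0 j)) i alpha u tau *
    (meval_io (Den (lift ord0 j)) i alpha u tau)^-1)//.
by rewrite /meval_io -xi_eq mulfK.
Qed.

Lemma trdeg_network_le (q' : nat) (out : pc_input -> time -> 'cV[R]_q') (d : nat) :
  (forall k : 'I_q', rational (fun u t => out u t k 0)) -> trdeg (obs_algebra out) d -> (d <= D)%N.
Proof. exact: (trdeg_obs_algebra_le t00 gen_causal gen_derivable). Qed.
End Generators.

Lemma output_has_D beta k u tau :
  has_D beta (fun v s => p v s k 0) u tau (\sum_h matC Sg k h * sigma (y beta h u tau)).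
Proof.
rewrite /has_D.
have -> : ext (fun s => p (splice u tau beta) s k 0) = (fun t => \sum_h matC Sg k h *
    ext (state_io h (splice u tau beta)) t).
  apply/funext => t; rewrite /ext; have [_ _ _ _ ->] := xP (splice u tau beta).
  by rewrite mxE.
apply: right_derivative_sum => h; apply: right_derivativeZ; exact: state_has_D.
Qed.

Lemma trdeg_output_le d : U -> trdeg (obs_algebra p) d -> (d <= n * (1 + #|` U| * N))%N.
Proof.
move=> alpha0 tr; have [a0 [t0 [l0 [t00 generic]]]] := exists_generic_word alpha0.
pose I : finType := ('I_n + 'I_n * U * 'I_N)%type.
have -> : (n * (1 + #|` U| * N))%N = #|I|.
  by rewrite card_sum !card_prod !card_ord cardfE mulnDr muln1 mulnA.
pose gI (k : I) : io_fun := match k with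
  inl h => state_io h | inr (i, alpha, j) => xi_io j i alpha end.
have g_cases (e : 'I_#|I|) : (exists h, gI (enum_val e) = state_io h) \/
    (exists j i alpha, gI (enum_val e) = xi_io j i alpha).
  by case: (enum_val e) => [h|[[i alpha] j]]; [left; exists h|right; exists j, i, alpha].
have g_xi j i alpha : exists e : 'I_#|I|, gI (enum_val e) = xi_io j i alpha.
  by exists (enum_rank (inr (i, alpha, j) : I)); rewrite enum_rankK.
apply: (trdeg_network_le t00 generic g_cases g_xi _ tr) => k.
have -> : (fun u t => p u t k 0) = (fun u t => \sum_h matC Sg k h * state_io h u t).
  by apply/funext => u; apply/funext => t; have [_ _ _ _ ->] := xP u; rewrite mxE.
apply: (germ_rational_sum g_cases) => h.
have <- : gI (enum_val (enum_rank (inl h : I))) = state_io h by rewrite enum_rankK.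
by apply: (germ_rational_gen _ _ _ (gen_causal g_cases)).
Qed.

(** The components of [hat p] are linear combinations of the [sigma (y beta h)], already rational in
    the [xi_io]. *)
Lemma trdeg_hat_output_le d : U -> trdeg (obs_algebra (hat p)) d -> (d <= n * #|` U| * N)%N.
Proof.
move=> alpha0 tr; have [a0 [t0 [l0 [t00 generic]]]] := exists_generic_word alpha0.
pose I : finType := ('I_n * U * 'I_N)%type.
have -> : (n * #|` U| * N)%N = #|I| by rewrite !card_prod !card_ord cardfE.
pose gI (k : I) : io_fun := xi_io k.2 k.1.1 k.1.2.
have g_cases (e : 'I_#|I|) : (exists h, gI (enum_val e) = state_io h) \/
    (exists j i alpha, gI (enum_val e) = xi_io j i alpha).
  by right; exists (enum_val e).2, (enum_val e).1.1, (enum_val e).1.2.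
have g_xi j i alpha : exists e : 'I_#|I|, gI (enum_val e) = xi_io j i alpha.
  by exists (enum_rank ((i, alpha, j) : I)); rewrite /gI enum_rankK.
apply: (trdeg_network_le t00 generic g_cases g_xi _ tr) => k.
case/mxvec_indexP: k => e k.
have -> : (fun u t => hat p u t (mxvec_index e k) 0) =
    (fun u t => \sum_h matC Sg k h * sigma (y (enum_val e) h u t)).
  apply/funext => u; apply/funext => t; rewrite /hat mxE mxvecE mxE.
  by apply: has_D_E; exact: output_has_D.
by apply: (germ_rational_sum g_cases) => h; exact: (sigma_rational generic g_cases g_xi).
Qed.
End NetworkAlgebra.

(** Without inputs all maps would be equal, and [iota] would identify 0 with 1. An input provides a
    letter, hence a nonempty [U]. *)
Lemma trdeg_input_exists (R : realType) (m : nat) (U : {fset 'cV[R]_m})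
    (S : set (io_fun U)) (d : nat) : trdeg S d -> exists u : pc_input U, True.
Proof.
move=> [L [iota [[[Scst _ _] iota1 iotaDM _ _] _]]].
apply: contrapT => noU; have E (phi psi : io_fun U) : phi = psi.
  by apply/funext => u; exfalso; apply: noU; exists u.
have [+ _] := iotaDM _ _ (Scst 0) (Scst 0).
rewrite (E (_ + _) 1) (E (cst (cst 0)) 1) iota1 => /eqP; rewrite -{1}[1]addr0 (inj_eq (addrI _)) eq_sym.
by rewrite oner_eq0.
Qed.

Theorem lemma7 (R : realType) (m q N : nat) (U : {fset 'cV[R]_m})
    (sigma : R -> R) (hsigma : assumption_A1 sigma N)
    (p : pc_input U -> time R -> 'cV[R]_q)
    (hp : forall u, piecewise_continuous (p u))
    (Sg : rnn m sigma q) (hreal : realization Sg p) :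
  trdeg (obs_algebra p) (rnn_dim Sg * (1 + #|` U| * N))%N \/
  trdeg (obs_algebra (hat p)) (rnn_dim Sg * #|` U| * N)%N ->
  sigma_minimal Sg p.
Proof.
move=> htr; split => // -[Sg' [real' dim]].
have [_ [N0 [xi [Num [Den [xi_an Den0 sE xE]]]]]] := hsigma.
have /choice[x xP] := real'.
have [u _] : exists u : pc_input U, True by case: htr => /trdeg_input_exists.
have alpha0 : U := u (NngNum (lexx (0 : R))).
have U0 : (0 < #|` U|)%N by rewrite cardfE; apply/card_gt0P; exists alpha0.
case: htr => tr.
  have := trdeg_output_le xi_an Den0 sE xE xP alpha0 tr.
  by rewrite leq_pmul2r// leqNgt dim.
have := trdeg_hat_output_le xi_an Den0 sE xE xP alpha0 tr.
by rewrite -!mulnA leq_pmul2r ?muln_gt0 ?U0// leqNgt dim.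
Qed.
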